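(* Let $h\in[1,n-1]$ and let $(C,\emptyset),(A,\Delta)\in\Xi_{n|n,d}$ with $\operatorname{ro}(A)=\operatorname{co}(C)$, where $C-E_{h+1,h}$ is a diagonal matrix and $\Delta=\{(i_1,j_1),\dots,(i_k,j_k)\}$. Write $A^p=A-E_{h,p}+E_{h+1,p}$. (a) If $i_t\ne h,h+1$ for all $t$, then $$e_{C,\emptyset}*e_{A,\Delta}=\sum_{p\in[1,n],\,a_{h,p}\ge1}v^{2\sum_{j<p}a_{h+1,j}}\frac{v^{2(a_{h+1,p}+1)}-1}{v^2-1}\,e_{A^p,\Delta}.$$ (b) If there is $m$ with $i_m=h$ and $i_{m+1}\ne h+1$, then $$\begin{aligned}e_{C,\emptyset}*e_{A,\Delta}=&\sum_{p\in[1,n],\,a_{h,p}\ge1}v^{2\sum_{j<p}a_{h+1,j}}\tfrac{v^{2(a_{h+1,p}+1)}-1}{v^2-1}e_{A^p,\Delta}\\&+\sum_{t\in[j_{m+1}+1,j_m-1]}v^{2\sum_{j\le j_{m+1}}a_{h+1,j}}e_{A^t,\Delta_t}+v^{2\sum_{j\le j_{m+1}}a_{h+1,j}}e_{A^{j_m},\Delta_b},\end{aligned}$$ where $\Delta_b=(\Delta\setminus\{(h,j_m)\})\cup\{(h+1,j_m)\}$ and $\Delta_t=\Delta\cup\{(h+1,t)\}$. (c) If there is $m$ with $i_{m-1}\ne h$ and $i_m=h+1$, then $$\begin{aligned}e_{C,\emptyset}*e_{A,\Delta}=&\sum_{p\ne j_m,\,a_{h,p}\ge1}v^{2\sum_{j<p}a_{h+1,j}}\tfrac{v^{2(a_{h+1,p}+1)}-1}{v^2-1}e_{A^p,\Delta}\\&+\sum_{p=j_m,\,a_{h,p}\ge1}v^{2(\sum_{j<p}a_{h+1,j}+1)}\tfrac{v^{2a_{h+1,p}}-1}{v^2-1}e_{A^p,\Delta}.\end{aligned}$$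 (d) If there is $m$ with $i_m=h$ and $i_{m+1}=h+1$, then $$\begin{aligned}e_{C,\emptyset}*e_{A,\Delta}=&\sum_{p\in[1,j_{m+1}-1]\cup[j_{m+1}+1,n],\,a_{h,p}\ge1}v^{2\sum_{j<p}a_{h+1,j}}\tfrac{v^{2(a_{h+1,p}+1)}-1}{v^2-1}e_{A^p,\Delta}\\&+\sum_{p=j_{m+1},\,a_{h,p}\ge1}v^{2(\sum_{j<p}a_{h+1,j}+1)}\tfrac{v^{2a_{h+1,p}}-1}{v^2-1}e_{A^p,\Delta}\\&+\sum_{p=j_m,\,a_{h,p}\ge1}\bigl(v^{2\sum_{j\le j_{m+1}}a_{h+1,j}}-v^{2\sum_{j<j_{m+1}}a_{h+1,j}}\bigr)e_{A^p,\Delta_s}\\&+\sum_{p=t\in[j_{m+1}+1,j_m-1],\,a_{h,p}\ge1}\bigl(v^{2\sum_{j\le j_{m+1}}a_{h+1,j}}-v^{2\sum_{j<j_{m+1}}a_{h+1,j}}\bigr)e_{A^p,\Delta_t},\end{aligned}$$ where $\Delta_s=(\Delta\setminus\{(h,j_m),(h+1,j_{m+1})\})\cup\{(h+1,j_m)\}$ and $\Delta_t=(\Delta\setminus\{(h+1,j_{m+1})\})\cup\{(h+1,t)\}$.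
   Context: Let $v$ be an indeterminate, $\mathcal{A}=\mathbb{Z}[v,v^{-1}]$, $n,d$ positive integers, $[a,b]$ the set of integers between $a$ and $b$ (empty if $a>b$), $\mathbb{N}=\{0,1,\dots\}$, $E_{k,l}$ the $n\times n$ matrix units. For a prime power $q$ let $V=\mathbb{F}_q^d$, $G=GL_d(\mathbb{F}_q)$, and $\mathscr{X}$ the set of flags $(0=V_0\subseteq V_1\subseteq\cdots\subseteq V_n=V)$ (inclusions not necessarily strict). $\Xi_{n|n,d}$ is the set of decorated matrices $(A,\Delta)$: $A=(a_{ij})$ is an $n\times n$ matrix over $\mathbb{N}$ with entries summing to $d$, and $\Delta=\{(i_1,j_1),\dots,(i_k,j_k)\}$ is a (possibly empty) set of positions with $i_1<\cdots<i_k$, $j_1>\cdots>j_k$ and $a_{ij}>0$ for all $(i,j)\in\Delta$; elements of $\Delta$ are always listed in this order. $\operatorname{ro}(A)$ and $\operatorname{co}(A)$ are the vectors of row sums and column sums of $A$. The $G$-orbits on $\mathscr{X}\times\mathscr{X}\times V$ are the sets $\mathcal{O}_{A,\Delta}$, $(A,\Delta)\in\Xi_{n|n,d}$: $\mathcal{O}_{A,\Delta}$ consists of the triples $((V_i),(V'_j),\omega)$ for which $V$ has a basis $\{e^s_{ij}:1\le s\le a_{ij}\}$ with $V_i=\mathrm{span}\{e^s_{i'j}:i'\le i\}$, $V'_j=\mathrm{span}\{e^s_{ij'}:j'\le j\}$, $\omega=\sum_{(i,j)\in\Delta}e^1_{ij}$. $\mathcal{MS}_{n,d}=\mathcal{A}_G(\mathscr{X}\times\mathscr{X}\times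 V)$ is the free $\mathcal{A}$-module on the characteristic functions $e_{A,\Delta}$ of the orbits, with the convolution product $(g*h)(f,f',\omega)=\sum_{f''\in\mathscr{X},\mu\in V}g(f,f'',\mu)h(f'',f',\omega-\mu)$ in the generic sense: the structure constants are the elements of $\mathcal{A}$ which for every prime power $q$ specialize at $v=\sqrt q$ to those of this convolution. Conventions: if $\Delta$ has $k$ elements, put $j_t=0$ for $t>k$, and conditions such as $i_{m+1}\neq h+1$ or $i_{m-1}\ne h$ hold automatically when the index is outside $[1,k]$; $e_{A',\Delta'}$ is read as $0$ whenever $(A',\Delta')\notin\Xi_{n|n,d}$ (e.g. when $A'$ has a negative entry or $\Delta'$ contains a position where $A'$ has entry $0$). *)

(* Defs.v *)
From HB Require Import structures.
From mathcomp Require Import all_boot all_order all_algebra all_field.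
From mathcomp Require Import boolp classical_sets.

Set Implicit Arguments.
Unset Strict Implicit.
Unset Printing Implicit Defensive.

Import GRing.Theory Num.Theory.
Local Open Scope ring_scope.

(* The ring Z[v, v^-1], as a subring of the fraction field of Z[v]. *)

Notation ratfun := {fraction {poly int}}.

Definition vfrac : ratfun := tofrac 'X.

Definition is_laurent : {pred ratfun} :=
  fun x => `[< exists (m : nat) (p : {poly int}), x = tofrac p / vfrac ^+ m >].

Lemma vfrac_neq0 : vfrac != 0.
Proof. by rewrite tofrac_eq0 polyX_eq0. Qed.

Lemma is_laurentP x :
  reflect (exists (m : nat) (p : {poly int}), x = tofrac p / vfrac ^+ m)
          (x \in is_laurent).
Proof. exact: asboolP. Qed.

Lemma is_laurent_tofrac p : tofrac p \in is_laurent.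
Proof. by apply/is_laurentP; exists 0%N, p; rewrite expr0 divr1. Qed.

Fact is_laurent_subring : subring_closed is_laurent.
Proof.
split.
- by rewrite -tofrac1 is_laurent_tofrac.
- move=> _ _ /is_laurentP[m [p ->]] /is_laurentP[l [q ->]].
  apply/is_laurentP; exists (m + l)%N, (p * 'X^l - q * 'X^m).
  rewrite tofracB !tofracM !tofracXn -/vfrac exprD mulrBl.
  by rewrite -mulf_div divff ?expf_neq0 ?vfrac_neq0 // mulr1
    [vfrac ^+ m * _]mulrC -mulf_div divff ?expf_neq0 ?vfrac_neq0 // mulr1.
- move=> _ _ /is_laurentP[m [p ->]] /is_laurentP[l [q ->]].
  apply/is_laurentP; exists (m + l)%N, (p * q).
  by rewrite tofracM exprD mulf_div.
Qed.

HB.instance Definition _ :=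
  GRing.isSubringClosed.Build ratfun is_laurent is_laurent_subring.

Record laurent :=
  Laurent { laurent_val : ratfun; _ : laurent_val \in is_laurent }.

HB.instance Definition _ := [isSub for laurent_val].
HB.instance Definition _ := [Choice of laurent by <:].
HB.instance Definition _ := [SubChoice_isSubComNzRing of laurent by <:].

Definition v : laurent := Laurent (is_laurent_tofrac 'X).

Fact is_laurent_geom (b : nat) :
  (vfrac ^+ (2 * b) - 1) / (vfrac ^+ 2 - 1) \in is_laurent.
Proof.
have nz : vfrac ^+ 2 - 1 != 0.
  rewrite subr_eq0 -tofrac1 -tofracXn tofrac_eq; apply/eqP.
  by move/(congr1 (fun p : {poly int} => size p)); rewrite size_polyXn size_poly1.
rewrite exprM -[X in _ ^+ b - X](expr1n _ b) subrXX mulrAC divff // mul1r.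
apply: rpred_sum => i _; rewrite expr1n mulr1.
by rewrite -exprM -tofracXn is_laurent_tofrac.
Qed.

Definition qint (b : nat) : laurent := Laurent (is_laurent_geom b).

(* Value of x in Z[v, v^-1] at v = a: if x = p / v^m then p(a) / a^m, for any
   choice of m and p when a != 0. *)
Definition laurent_ev (a : algC) (x : laurent) : algC :=
  let mp := xget (0%N, 0)
    [set mp : nat * {poly int} | val x = tofrac mp.2 / vfrac ^+ mp.1]%classic in
  (map_poly intr mp.2).[a] / a ^+ mp.1.

Lemma laurent_evE (a : algC) (x : laurent) m p : a != 0 ->
  val x = tofrac p / vfrac ^+ m ->
  laurent_ev a x = (map_poly intr p).[a] / a ^+ m.
Proof.
move=> a0 xE; rewrite /laurent_ev; case: xgetP => [[l q] _ /= xE'|/(_ (m, p))//].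
have : tofrac q / vfrac ^+ l == tofrac p / vfrac ^+ m by rewrite -xE -xE'.
rewrite eqr_div ?expf_neq0 ?vfrac_neq0 // -!tofracXn -!tofracM tofrac_eq.
move=> /eqP/(congr1 (fun r => (map_poly (intr : int -> algC) r).[a])).
rewrite !rmorphM /= !map_polyXn !hornerM !hornerXn => e.
by apply/eqP; rewrite eqr_div ?expf_neq0 //; apply/eqP.
Qed.

(* Rows and columns are indexed by 'I_n; the index i is the row or column number
   [lbl i] in [1, n]. *)

Definition lbl n (i : 'I_n) : nat := i.+1.

Definition dlist n (D : {set 'I_n * 'I_n}) : seq ('I_n * 'I_n) :=
  sort (fun x y : 'I_n * 'I_n => (x.1 <= y.1)%N) (enum D).

(* With D = {(i_1,j_1), ..., (i_k,j_k)}, [drow D t] is i_t and [dcol D t] is j_t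
   for 1 <= t <= k; both are 0, which is no row or column number, for all other
   t. *)
Definition drow n (D : {set 'I_n * 'I_n}) (t : nat) : nat :=
  nth 0%N (0%N :: [seq lbl x.1 | x <- dlist D]) t.
Definition dcol n (D : {set 'I_n * 'I_n}) (t : nat) : nat :=
  nth 0%N (0%N :: [seq lbl x.2 | x <- dlist D]) t.

Definition decorated n (d : nat) (A : 'M[nat]_n) (D : {set 'I_n * 'I_n}) : bool :=
  [&& (\sum_(i < n) \sum_(j < n) A i j == d)%N,
      sorted (fun x y : 'I_n * 'I_n => (x.1 < y.1) && (y.2 < x.2))%N (dlist D)
    & [forall x in D, (0 < A x.1 x.2)%N]].

Record Xi n d := XiOf {
  Xi_val : 'M[nat]_n * {set 'I_n * 'I_n};
  _ : decorated d Xi_val.1 Xi_val.2 }.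

HB.instance Definition _ n d := [isSub for @Xi_val n d].
HB.instance Definition _ n d := [Countable of Xi n d by <:].

Section XiFinite.
Variables n d : nat.

Let code (x : Xi n d) : 'M['I_d.+1]_n * {set 'I_n * 'I_n} :=
  (map_mx inord (val x).1, (val x).2).
Let decode (y : 'M['I_d.+1]_n * {set 'I_n * 'I_n}) : option (Xi n d) :=
  insub (map_mx (@nat_of_ord _) y.1, y.2).

Let codeK : pcancel code decode.
Proof.
move=> x; rewrite /decode.
suff -> : (map_mx (@nat_of_ord _) (code x).1, (code x).2) = val x.
  exact: valK.
case: x => -[A D] /= Ax; suff -> : map_mx (@nat_of_ord _) (map_mx inord A : 'M['I_d.+1]_n) = A by [].
apply/matrixP => i j; rewrite !mxE inordK //.
case/and3P: Ax => /eqP dE _ _; rewrite /= in dE.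
by rewrite -[X in (_ < X.+1)%N]dE ltnS (bigD1 i) //= (bigD1 j) //= -addnA leq_addr.
Qed.

HB.instance Definition _ : isFinite (Xi n d) := PCanIsFinite codeK.
End XiFinite.

Definition ro n (A : 'M[nat]_n) : 'rV[nat]_n := \row_i (\sum_(j < n) A i j)%N.
Definition co n (A : 'M[nat]_n) : 'rV[nat]_n := \row_j (\sum_(i < n) A i j)%N.

Section Geometry.
Variables (F : finFieldType) (n d : nat).

Let vspaceK := @VectorInternalTheory.vs2mxK F 'rV[F]_d.
HB.instance Definition _ : isCountable {vspace 'rV[F]_d} := CanIsCountable vspaceK.
HB.instance Definition _ : isFinite {vspace 'rV[F]_d} := CanIsFinite vspaceK.

Definition is_flag (f : {ffun 'I_n.+1 -> {vspace 'rV[F]_d}}) : bool :=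
  [&& f ord0 == 0%VS, f ord_max == fullv
    & [forall i : 'I_n, f (widen_ord (leqnSn n) i) <= f (lift ord0 i)]%VS].

Record flag := Flag {
  flag_val :> {ffun 'I_n.+1 -> {vspace 'rV[F]_d}};
  _ : is_flag flag_val }.

HB.instance Definition _ := [isSub for flag_val].
HB.instance Definition _ := [Finite of flag by <:].

(* The vectors e^s_{ij}, 1 <= s <= a_{ij}, with (i, j) in P. *)
Definition block_seq (A : 'M[nat]_n) (e : 'I_n * 'I_n -> nat -> 'rV[F]_d)
    (P : pred ('I_n * 'I_n)) : seq 'rV[F]_d :=
  [seq e x s | x <- enum P, s <- iota 1 (A x.1 x.2)].

Definition in_orbit (x : Xi n d) (f f' : flag) (w : 'rV[F]_d) : Prop :=
  let A := (val x).1 in let D := (val x).2 in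
  exists e : 'I_n * 'I_n -> nat -> 'rV[F]_d,
  [/\ basis_of fullv (block_seq A e predT),
      forall i : 'I_n.+1, f i = <<block_seq A e [pred x | lbl x.1 <= i]%N>>%VS,
      forall j : 'I_n.+1, f' j = <<block_seq A e [pred x | lbl x.2 <= j]%N>>%VS
    & w = \sum_(x in D) e x 1%N].

Definition orbit_char (x : Xi n d) (f f' : flag) (w : 'rV[F]_d) : algC :=
  (`[< in_orbit x f f' w >])%:R.

Definition conv (g h : flag -> flag -> 'rV[F]_d -> algC)
    (f f' : flag) (w : 'rV[F]_d) : algC :=
  \sum_(f'' : flag) \sum_(mu : 'rV[F]_d) g f f'' mu * h f'' f' (w - mu).

End Geometry.

Definition MS n d := {ffun Xi n d -> laurent^o}.

(* Letting F range over all finite fields amounts to letting q = #|F| range over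
   all prime powers.  A Laurent polynomial is determined by its values at the
   numbers sqrt q, so at most one c satisfies this. *)
Definition is_struct_const n d (x y : Xi n d) (c : MS n d) : Prop :=
  forall (F : finFieldType) (f f' : flag F n d) (w : 'rV[F]_d),
    conv (orbit_char x) (orbit_char y) f f' w =
    \sum_(z : Xi n d) laurent_ev (sqrtC #|F|%:R) (c z) * orbit_char z f f' w.

Definition struct_const n d (x y : Xi n d) : MS n d :=
  xget 0 [set c | is_struct_const x y c]%classic.

Definition MS_mul n d (g h : MS n d) : MS n d :=
  \sum_(x : Xi n d) \sum_(y : Xi n d) ((g x : laurent) * h y) *: struct_const x y.

(* The basis element e_{M,D}, or 0 when (M, D) is not a decorated matrix; integer
   entries allow M to have negative ones. *)
Definition ebas n d (M : 'M[int]_n) (D : {set 'I_n * 'I_n}) : MS n d :=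
  if [pick x : Xi n d | (map_mx Posz (val x).1 == M) && ((val x).2 == D)] is Some x
  then [ffun y => (y == x)%:R] else 0.

Definition move n (h h' : 'I_n) (A : 'M[nat]_n) (p : 'I_n) : 'M[int]_n :=
  map_mx Posz A - delta_mx h p + delta_mx h' p.

(* Main.v *)
Require Import Defs.
From HB Require Import structures.
From mathcomp Require Import all_boot all_order all_algebra all_field.
From mathcomp Require Import boolp.
From mathcomp Require classical_sets.
From mathcomp Require Import zify ring.
Import Defs.

Set Implicit Arguments.
Unset Strict Implicit.
Unset Printing Implicit Defensive.

Import Order.TTheory GRing.Theory Num.Theory.
Local Open Scope ring_scope.

(** At v = sqrt q, the coefficient of e_{B,E} in e_{C,0} * e_{A,D} counts the
    flags g with (f, g, 0) in the orbit of (C, 0) and (g, f', w) in the orbit of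
    (A, D), for one fixed (f, f', w) in the orbit of (B, E).  A Laurent
    polynomial is determined by its values at infinitely many points
    ([laurent_ev_prime_inj]) and every orbit is inhabited ([orbit_nonempty]), so
    the product is known once these numbers are ([MS_mul_count]).

    The count is possible because orbits are recognized by numerical invariants
    ([in_orbitE]): the dimensions of the intersections of the steps of f and f',
    which are sums of entries of A over upper left corners ([corner]), and, for
    each step f_i, the least j such that w lies in f_i + f'_j ([reach]).  That
    the invariants suffice rests on the existence of a basis adapted to both
    flags in which w is a sum of basis vectors at positions forming an antichain
    ([orbit_exists]).  Such a basis comes from writing w as a sum of vectors of
    the subspaces f_i \cap f'_j in the cheapest way ([minimal_cell_sum]) and
    completing the terms to bases of complements of the lower intersections.

    Since C - E_{h+1,h} is diagonal, g differs from f in the step of label h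
    only, where it is a subspace Y with f_h < Y <= f_{h+1} of dimension
    dim f_h + 1 ([elementary_orbitP]).  If p is the first column with
    Y <= f_h + f'_p, then passing from g to f moves a unit of column p from row h
    to row h + 1, so B = A^p; and the reaches of D and E agree except at h, where
    they are s and t respectively ([intermediate_flags_move],
    [card_intermediate_flags]).  It remains to count the lines Y / f_h with
    position p for which the reach of w at Y is s.

    Let r be the common reach of D and E at h + 1.  If s = t, all lines at
    position p qualify except, when r < s and p = s, those that catch w already
    modulo f'_{s-1}.  If s < t, let j = s: modulo f'_j the vector w has a nonzero
    image in f_{h+1} / (f_h + f_{h+1} \cap f'_j), and Y catches it exactly when
    it is one of the lines over that image, all of which have position t
    ([line_catches], [line_catches_position]).  From these lines those that catch
    w already modulo f'_{s-1} are removed, which is the same count one step lower,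
    and empty unless r < s.  If s > t every line catches w already modulo f'_t,
    and none qualifies.  Each of these sets is counted by [card_line_between], and
    the result is [move_coef].  The four cases of the theorem are the four ways in
    which each of r <= s <= sigma can be strict or not, sigma being the reach of D
    at h - 1; the set E with a given t is [transfer]. *)

(** * Evaluation of Laurent polynomials *)

Lemma sub_div (K : fieldType) (x y a b : K) : a != 0 -> b != 0 ->
  x / a - y / b = (x * b - y * a) / (a * b).
Proof. by move=> a0 b0; field; rewrite a0 b0. Qed.

Section LaurentEvaluation.
Variables (a : algC) (a0 : a != 0).

Lemma laurent_ev_zmod_morphism : zmod_morphism (laurent_ev a).
Proof.
move=> x y; have [m [p xE]] := is_laurentP _ (valP x).
have [l [q yE]] := is_laurentP _ (valP y).
rewrite (laurent_evE a0 xE) (laurent_evE a0 yE).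
have zE : val (x - y) = tofrac (p * 'X^l - q * 'X^m) / vfrac ^+ (m + l).
  rewrite raddfB /= [laurent_val x]xE [laurent_val y]yE tofracB !tofracM !tofracXn -/vfrac.
  by rewrite exprD sub_div ?expf_neq0 ?vfrac_neq0.
rewrite (laurent_evE a0 zE) rmorphB /= !rmorphM /= !map_polyXn !hornerE.
by rewrite exprD sub_div ?expf_neq0.
Qed.

Lemma laurent_ev_monoid_morphism : monoid_morphism (laurent_ev a).
Proof.
split.
  have oneE : val (1 : laurent) = tofrac 1 / vfrac ^+ 0 by rewrite tofrac1 divr1.
  by rewrite (laurent_evE a0 oneE) rmorph1 hornerE divr1.
move=> x y; have [m [p xE]] := is_laurentP _ (valP x).
have [l [q yE]] := is_laurentP _ (valP y).
rewrite (laurent_evE a0 xE) (laurent_evE a0 yE).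
have zE : val (x * y) = tofrac (p * q) / vfrac ^+ (m + l).
  by rewrite rmorphM /= [laurent_val x]xE [laurent_val y]yE tofracM exprD mulf_div.
by rewrite (laurent_evE a0 zE) rmorphM /= hornerM mulf_div exprD.
Qed.

End LaurentEvaluation.

(** The proof that a is nonzero is an argument so that the evaluation can carry
    its ring morphism structure. *)
Definition evm (a : algC) of a != 0 := laurent_ev a.

HB.instance Definition _ (a : algC) (a0 : a != 0) :=
  GRing.isZmodMorphism.Build laurent algC (evm a0) (laurent_ev_zmod_morphism a0).
HB.instance Definition _ (a : algC) (a0 : a != 0) :=
  GRing.isMonoidMorphism.Build laurent algC (evm a0) (laurent_ev_monoid_morphism a0).

Lemma evm_v a (a0 : a != 0) : evm a0 v = a.
Proof.
have vE : val v = tofrac 'X / vfrac ^+ 0 by rewrite divr1.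
by rewrite /evm (laurent_evE a0 vE) map_polyX hornerX divr1.
Qed.

Lemma evm_qint a (a0 : a != 0) b :
  (a ^+ 2 - 1) * evm a0 (qint b) = a ^+ (2 * b) - 1.
Proof.
have e : (v ^+ 2 - 1) * qint b = v ^+ (2 * b) - 1.
  apply: val_inj; rewrite rmorphM !rmorphB rmorph1 !rmorphXn /=.
  rewrite mulrCA divff ?mulr1 //.
  rewrite subr_eq0 -tofrac1 -tofracXn tofrac_eq; apply/eqP.
  by move/(congr1 (fun p : {poly int} => size p)); rewrite size_polyXn size_poly1.
by have /(congr1 (evm a0)) := e; rewrite rmorphM !rmorphB rmorph1 !rmorphXn /= evm_v.
Qed.

Fixpoint nth_prime_after (k : nat) : nat :=
  if k is k'.+1 then s2val (prime_above (nth_prime_after k')) else 2.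

Lemma nth_prime_after_prime k : prime (nth_prime_after k).
Proof. by case: k => //= k; case: prime_above. Qed.

Lemma nth_prime_after_mono : {homo nth_prime_after : i j / (i < j)%N}.
Proof.
apply: homo_ltn => [y x z|k]; first exact: ltn_trans.
by rewrite /=; case: prime_above.
Qed.

(** A Laurent polynomial is determined by its values at the square roots of the
    primes, because its numerator can only have finitely many zeros. *)
Lemma laurent_ev_prime_inj (x y : laurent) :
  (forall p, prime p -> laurent_ev (sqrtC p%:R) x = laurent_ev (sqrtC p%:R) y) ->
  x = y.
Proof.
move=> xy; apply/eqP; rewrite -subr_eq0; apply/eqP/val_inj.
have [m [P zE]] := is_laurentP _ (valP (x - y)).
rewrite /= [LHS]zE; suff -> : P = 0 by rewrite tofrac0 mul0r.
have root_p p : prime p -> root (map_poly intr P) (sqrtC p%:R : algC).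
  move=> pp; have a0 : sqrtC p%:R != 0 :> algC.
    by rewrite sqrtC_eq0 pnatr_eq0 -lt0n prime_gt0.
  have := laurent_evE a0 zE; rewrite (laurent_ev_zmod_morphism a0) xy // subrr.
  by move=> /esym/eqP; rewrite mulf_eq0 invr_eq0 (expf_eq0 _ m) (negPf a0) andbF orbF.
apply: (map_inj_poly (f := intr : int -> algC)) => //; first exact: intr_inj.
rewrite rmorph0; apply/eqP; apply/negPn/negP => P0.
pose N := size (map_poly (intr : int -> algC) P).
have /(_ [seq sqrtC (nth_prime_after k)%:R | k <- iota 0 N]) := max_poly_roots P0.
rewrite size_map size_iota ltnn => h; suff: false by []; apply: h.
  by apply/allP => _ /mapP[k _ ->]; apply/root_p/nth_prime_after_prime.
rewrite map_inj_uniq ?iota_uniq // => i j /(congr1 (fun z => z ^+ 2)).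
rewrite !sqrtCK => /eqP; rewrite eqr_nat => /eqP ij.
by case: (ltngtP i j) => // /nth_prime_after_mono; rewrite ij ltnn.
Qed.

(** * Spans of blocks of an adapted basis *)

Section BlockSpans.
Variables (F : finFieldType) (n d : nat) (A : 'M[nat]_n).
Variable e : 'I_n * 'I_n -> nat -> 'rV[F]_d.
Local Notation I := ('I_n * 'I_n)%type.
Local Notation span P := (<<block_seq A e P>>)%VS.
Implicit Types P Q : pred I.

Lemma eq_block_seq P Q : P =1 Q -> block_seq A e P = block_seq A e Q.
Proof. by move=> PQ; rewrite /block_seq (eq_enum PQ). Qed.

Lemma size_block_seq P : size (block_seq A e P) = (\sum_(x | P x) A x.1 x.2)%N.
Proof.
rewrite size_allpairs_dep sumnE big_map big_enum /=.
by apply: eq_bigr => x _; rewrite size_iota.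
Qed.

Lemma mem_block_seq P (x : I) s : P x -> (0 < s <= A x.1 x.2)%N ->
  e x s \in block_seq A e P.
Proof.
move=> Px sA; apply/allpairsPdep; exists x, s; split=> //.
  by rewrite mem_enum.
by rewrite mem_iota add1n ltnS.
Qed.

Lemma block_span_subv P (U : {vspace 'rV[F]_d}) :
  (forall (x : I) s, P x -> (0 < s <= A x.1 x.2)%N -> e x s \in U) ->
  (span P <= U)%VS.
Proof.
move=> PU; apply/span_subvP => _ /allpairsPdep[x [s [xP sA ->]]].
by apply: PU; rewrite ?mem_enum // in xP; move: sA; rewrite mem_iota add1n ltnS.
Qed.

Lemma block_spanS P Q : subpred P Q -> (span P <= span Q)%VS.
Proof.
move=> PQ; apply: block_span_subv => x s /PQ Qx sA.
exact/memv_span/mem_block_seq.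
Qed.

Lemma block_spanD P Q : (span P + span Q)%VS = span (predU P Q).
Proof.
apply/eqP; rewrite eqEsubv subv_add !block_spanS ?andbT /=; first last.
- by move=> x /= ->.
- by move=> x /= ->; rewrite orbT.
apply: block_span_subv => x s /orP[] xP sA.
  by apply: (subvP (addvSl _ _)); apply/memv_span/mem_block_seq.
by apply: (subvP (addvSr _ _)); apply/memv_span/mem_block_seq.
Qed.

Hypothesis eB : basis_of fullv (block_seq A e predT).

(** Both a block family and its complement span at most as many dimensions as
    they have vectors, and together they span everything. *)
Lemma dim_block_span P : \dim (span P) = (\sum_(x | P x) A x.1 x.2)%N.
Proof.
have full : (span P + span (predC P))%VS = fullv.
  rewrite block_spanD (@eq_block_seq _ predT) ?(span_basis eB) // => x /=.
  by rewrite orbN.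
have := dim_span (block_seq A e P); have := dim_span (block_seq A e (predC P)).
have := dimv_sum_cap (span P) (span (predC P)).
have := basis_free eB; rewrite /free (span_basis eB) => /eqP.
rewrite full !size_block_seq (bigID P) /=.
by lia.
Qed.

Lemma block_spanI P Q : (span P :&: span Q)%VS = span (predI P Q).
Proof.
symmetry; apply/eqP; rewrite eqEdim subv_cap; apply/andP; split.
  by rewrite !block_spanS // => x /= /andP[].
have := dimv_sum_cap (span P) (span Q); rewrite block_spanD !dim_block_span.
suff -> : (\sum_(x | P x) A x.1 x.2 + \sum_(x | Q x) A x.1 x.2 =
    \sum_(x | predU P Q x) A x.1 x.2 + \sum_(x | predI P Q x) A x.1 x.2)%N.
  by lia.
rewrite !(big_mkcond P) !(big_mkcond Q) !(big_mkcond (predU _ _)).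
rewrite (big_mkcond (predI _ _)) -!big_split; apply: eq_bigr => x _ /=.
by case: (P x); case: (Q x); rewrite /= ?addn0.
Qed.

(** If w = \sum_(x in D) e x 1 lies in a block span missing y in D, then e y 1
    is spanned by the other blocks, against linear independence. *)
Lemma mem_block_span (D : {set I}) P :
  (forall x, x \in D -> (0 < A x.1 x.2)%N) ->
  (\sum_(x in D) e x 1%N \in span P) = [forall x in D, P x].
Proof.
move=> Dpos; apply/idP/forall_inP => [wP y yD|DP]; last first.
  apply: rpred_sum => x xD; apply/memv_span/mem_block_seq; first exact: DP.
  by rewrite Dpos.
case: (boolP (P y)) => // Py; have eyD : e y 1%N \in block_seq A e predT.
  by apply: mem_block_seq => //; rewrite Dpos.
have: e y 1%N \in (span (pred1 y) :&: span (predC1 y))%VS.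
  rewrite memv_cap memv_span ?mem_block_seq ?Dpos ?eqxx //=.
  have -> : e y 1%N = \sum_(x in D) e x 1%N - \sum_(x in D | x != y) e x 1%N.
    by rewrite (bigD1 y) //= addrK.
  apply: rpredB.
    apply: subvP wP; apply: block_spanS => x Px.
    by apply: contraNneq Py => <-.
  apply: rpred_sum => x /andP[xD xy].
  by apply/memv_span/mem_block_seq; rewrite ?Dpos.
rewrite block_spanI (@eq_block_seq _ pred0); last by move=> x /=; case: eqP.
rewrite /block_seq enum0 span_nil memv0 => /eqP ey0.
have /andP[_ /free_not0 /(_ eyD)] : basis_of fullv (block_seq A e predT) by [].
by rewrite ey0 eqxx.
Qed.

End BlockSpans.

(** * Corner sums and staircases *)

(** In the orbit of (A, D) this is the dimension of f_i \cap f'_j. *)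
Definition corner n (A : 'M[nat]_n) (i j : nat) : nat :=
  \sum_(x : 'I_n * 'I_n | (x.1 < i)%N && (x.2 < j)%N) A x.1 x.2.

(** Inclusion-exclusion; it recovers the entries of A from the corner sums. *)
Lemma cornerS n (A : 'M[nat]_n) (i j : 'I_n) :
  (corner A i.+1 j.+1 + corner A i j = A i j + corner A i.+1 j + corner A i j.+1)%N.
Proof.
rewrite /corner !(big_mkcond (fun x : 'I_n * 'I_n => (_ < _)%N && _)).
have -> : A i j = (\sum_(x : 'I_n * 'I_n) if x == (i, j) then A x.1 x.2 else 0)%N.
  by rewrite -big_mkcond big_pred1_eq.
rewrite -!big_split; apply: eq_bigr => -[a b] _ /=.
rewrite xpair_eqE -!val_eqE /= !ltnS.
by case: (ltngtP a i); case: (ltngtP b j) => //=; rewrite ?addn0.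
Qed.

Lemma corner_inj n (A B : 'M[nat]_n) :
  (forall i j, corner A i j = corner B i j) -> A = B.
Proof.
move=> AB; apply/matrixP => i j.
by have := cornerS A i j; have := cornerS B i j; rewrite !AB; lia.
Qed.

Lemma corner0l n (A : 'M[nat]_n) j : corner A 0 j = 0%N.
Proof. by rewrite /corner big_pred0. Qed.

Lemma corner0r n (A : 'M[nat]_n) i : corner A i 0 = 0%N.
Proof. by rewrite /corner big_pred0 // => x; rewrite andbF. Qed.

(** The condition i_1 < ... < i_k, j_1 > ... > j_k without the listing. *)
Definition antichain n (D : {set 'I_n * 'I_n}) : Prop :=
  forall x y, x \in D -> y \in D ->
  ((x.1 < y.1)%N -> (y.2 < x.2)%N) /\ (x.1 = y.1 -> x = y).

(** In the orbit of (A, D) this is the least j with w in f_i + f'_j: rows are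
    counted from 0, so the rows i, i + 1, ... are those outside f_i. *)
Definition reach n (D : {set 'I_n * 'I_n}) (i : nat) : nat :=
  \max_(x in D | (i <= x.1)%N) (x.2 : nat).+1.

Lemma reach_leP n (D : {set 'I_n * 'I_n}) i j :
  reflect (forall x, x \in D -> (i <= x.1)%N -> (x.2 < j)%N) (reach D i <= j)%N.
Proof.
apply: (iffP (@bigmax_leqP _ _ _ _)) => h x; first by move=> xD ix; rewrite h ?xD.
by case/andP=> xD ix; rewrite h.
Qed.

Lemma leq_reach n (D : {set 'I_n * 'I_n}) (i : nat) x :
  x \in D -> (i <= x.1)%N -> (x.2 < reach D i)%N.
Proof. by move=> xD ix; apply: (reach_leP D i _ (leqnn _)). Qed.

Lemma reach_homo n (D : {set 'I_n * 'I_n}) i i' :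
  (i <= i')%N -> (reach D i' <= reach D i)%N.
Proof.
by move=> ii'; apply/reach_leP => x xD i'x; apply: leq_reach => //; lia.
Qed.

(** The reach is a descending staircase whose corners are the elements of D. *)
Lemma mem_antichain n (D : {set 'I_n * 'I_n}) (x : 'I_n * 'I_n) : antichain D ->
  (x \in D) = (reach D x.1 == x.2.+1) && (reach D x.1.+1 <= x.2)%N.
Proof.
move=> Dc; apply/idP/andP => [xD|[/eqP rx rx']].
  split; last by apply/reach_leP => y yD; apply: (Dc x y xD yD).1.
  rewrite eqn_leq leq_reach // andbT; apply/reach_leP => y yD.
  rewrite leq_eqVlt => /orP[/eqP/val_inj/(Dc x y xD yD).2 <-//|].
  by move=> /(Dc x y xD yD).1 /ltnW.
case: (boolP (x \in D)) => // xD.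
suff : (reach D x.1 <= x.2)%N by rewrite rx ltnn.
apply/reach_leP => y yD; rewrite leq_eqVlt => /orP[/eqP xy|xy]; last first.
  by have /(_ y yD xy) := reach_leP D _ _ rx'.
have : (y.2 < x.2.+1)%N by rewrite -rx leq_reach // xy.
rewrite ltnS leq_eqVlt => /orP[/eqP xy2|//]; case/negP: xD.
by rewrite (_ : x = y) // [x]surjective_pairing [y]surjective_pairing
  (val_inj xy) (val_inj xy2).
Qed.

Lemma reach_inj n (D E : {set 'I_n * 'I_n}) : antichain D -> antichain E ->
  reach D =1 reach E -> D = E.
Proof.
by move=> Dc Ec DE; apply/setP => x; rewrite !mem_antichain // !DE.
Qed.

(** Trades the sorted list in the definition of a decorated matrix for the
    antichain condition, which does not depend on an enumeration. *)
Lemma decoratedE n d (A : 'M[nat]_n) (D : {set 'I_n * 'I_n}) :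
  decorated d A D <->
  [/\ corner A n n = d, antichain D & forall x, x \in D -> (0 < A x.1 x.2)%N].
Proof.
have sumE : (\sum_(i < n) \sum_(j < n) A i j)%N = corner A n n.
  rewrite pair_bigA /corner /=; apply: eq_bigl => x.
  by rewrite !ltn_ord.
have memd x : (x \in dlist D) = (x \in D) by rewrite mem_sort mem_enum.
rewrite /decorated sumE; split.
  case/and3P=> /eqP -> Ds /forall_inP Dpos; split=> // x y xD yD.
  have tr : transitive (fun x y : 'I_n * 'I_n => (x.1 < y.1) && (y.2 < x.2))%N.
    by move=> a b c /andP[? ?] /andP[? ?]; apply/andP; lia.
  have [xy|yx|xy] := ltngtP (index x (dlist D)) (index y (dlist D)).
  - have := sorted_ltn_index tr Ds; move=> /(_ x y); rewrite !memd => /(_ xD yD xy) /andP[h1 h2].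
    by split=> // e; rewrite e ltnn in h1.
  - have := sorted_ltn_index tr Ds; move=> /(_ y x); rewrite !memd => /(_ yD xD yx) /andP[h1 h2].
    by split=> [xy|e]; [have := ltn_trans xy h1; rewrite ltnn | rewrite e ltnn in h1].
  - have -> : x = y by apply: (index_inj x (s := dlist D)); rewrite ?memd.
    by rewrite ltnn.
case=> -> Dc Dpos; rewrite eqxx /=; apply/andP; split; last exact/forall_inP.
apply: pairwise_sorted.
have tot : total (fun x y : 'I_n * 'I_n => (x.1 <= y.1)%N) by move=> x y; apply: leq_total.
have tr : transitive (fun x y : 'I_n * 'I_n => (x.1 <= y.1)%N).
  by move=> x y z; apply: leq_trans.
have := sort_sorted tot (enum D); rewrite (sorted_pairwise tr).
have : uniq (dlist D) by rewrite sort_uniq enum_uniq.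
rewrite uniq_pairwise => u s; have := conj u s => /andP; rewrite -pairwise_relI.
apply: (sub_in_pairwise (P := mem D)) => [x y xD yD|]; last first.
  by apply/allP => x; rewrite memd.
move=> /andP[/= xy]; rewrite leq_eqVlt => /orP[/eqP/val_inj/(Dc x y xD yD).2 e|h].
  by rewrite e eqxx in xy.
by rewrite h (Dc x y xD yD).1.
Qed.

Lemma Xi_decorated n d (x : Xi n d) : decorated d (val x).1 (val x).2.
Proof. by case: x. Qed.

(** * Numerical invariants of a triple *)

Section FlagInvariants.
Variables (F : finFieldType) (n d : nat).
Implicit Types (f : flag F n d) (w : 'rV[F]_d).

(** Saturating the index at n makes the steps monotone along all of nat. *)
Definition flag_at f (i : nat) : {vspace 'rV[F]_d} := f (inord (minn i n)).

Lemma flag_atE f (i : 'I_n.+1) : flag_at f i = f i.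
Proof.
by congr (f _); apply: val_inj; rewrite /= inordK; case: i => i /=; lia.
Qed.

Lemma flag_at0 f : flag_at f 0 = 0%VS.
Proof.
case: f => f /=; rewrite /flag_at /= min0n => /and3P[/eqP f0 _ _].
by rewrite -[RHS]f0; congr (f _); apply: val_inj; rewrite /= inordK.
Qed.

Lemma flag_at_full f i : (n <= i)%N -> flag_at f i = fullv.
Proof.
case: f => f /=; rewrite /flag_at /= => /and3P[_ /eqP fn _] /minn_idPr ->.
by rewrite -[RHS]fn; congr (f _); apply: val_inj; rewrite /= inordK.
Qed.

Lemma flag_atS f i : (flag_at f i <= flag_at f i.+1)%VS.
Proof.
have [ni|ni] := leqP n i; first by rewrite !flag_at_full // (leq_trans ni).
case: f => f ff; rewrite /flag_at /=; case/and3P: (ff) => _ _ /forallP/(_ (Ordinal ni)).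
congr (_ <= _)%VS; congr (f _); apply: val_inj; rewrite /= inordK; try lia.
by rewrite /bump; lia.
Qed.

Lemma flag_at_homo f i j : (i <= j)%N -> (flag_at f i <= flag_at f j)%VS.
Proof.
elim: j => [|j IH]; first by rewrite leqn0 => /eqP ->.
rewrite leq_eqVlt ltnS => /orP[/eqP -> //|/IH h].
exact: subv_trans h (flag_atS f j).
Qed.

Lemma flag_inj f f' : (forall i, flag_at f i = flag_at f' i) -> f = f'.
Proof. by move=> ff'; apply/val_inj/ffunP => i; rewrite -!flag_atE ff'. Qed.

(** The numerical invariants that characterize an orbit: the first table
    determines A by inclusion-exclusion, the second determines D as the staircase
    of the sums f_i + f'_j containing w. *)
Definition has_position (A : 'M[nat]_n) (D : {set 'I_n * 'I_n}) f f' w : Prop :=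
  (forall i j, \dim (flag_at f i :&: flag_at f' j) = corner A i j) /\
  (forall i j, (w \in flag_at f i + flag_at f' j)%VS = (reach D i <= j)%N).

Lemma has_position_inj (x y : Xi n d) f f' w :
  has_position (val x).1 (val x).2 f f' w ->
  has_position (val y).1 (val y).2 f f' w -> x = y.
Proof.
move=> [xd xw] [yd yw]; apply: val_inj.
rewrite [LHS]surjective_pairing [RHS]surjective_pairing; congr (_, _).
  by apply: corner_inj => i j; rewrite -xd yd.
have /decoratedE[_ Dx _] := Xi_decorated x.
have /decoratedE[_ Dy _] := Xi_decorated y.
apply: reach_inj => // i.
by apply/eqP; rewrite eqn_leq -xw yw leqnn -yw xw leqnn.
Qed.

(** In an adapted basis, f_i, f'_j, their intersection and their sum are all
    spanned by blocks, so both tables can be read off. *)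
Lemma in_orbit_has_position (x : Xi n d) f f' w :
  in_orbit x f f' w -> has_position (val x).1 (val x).2 f f' w.
Proof.
have /decoratedE[_ Dc Dpos] := Xi_decorated x.
case: x Dc Dpos => -[A D] /= _ Dc Dpos [e /= [eB fE f'E ->]].
have rowE i : flag_at f i = <<block_seq A e (fun x => x.1 < i)%N>>%VS.
  rewrite /flag_at fE; congr <<_>>%VS; apply: eq_block_seq => x /=.
  by rewrite inordK /lbl; have := ltn_ord x.1; lia.
have colE i : flag_at f' i = <<block_seq A e (fun x => x.2 < i)%N>>%VS.
  rewrite /flag_at f'E; congr <<_>>%VS; apply: eq_block_seq => x /=.
  by rewrite inordK /lbl; have := ltn_ord x.2; lia.
split=> i j; rewrite rowE colE; first by rewrite block_spanI // dim_block_span.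
rewrite block_spanD mem_block_span //; apply/forall_inP/reach_leP => h y yD /=.
  by move=> iy; case/orP: (h y yD) => //=; rewrite ltnNge iy.
by have := h y yD; case: (leqP i) => //= _ ->.
Qed.

End FlagInvariants.

(** * Existence of adapted bases *)

Section SubspaceLemmas.
Variables (K : fieldType) (V : vectType K).
Implicit Types U W R : {vspace V}.

Lemma dim_add_line R (g : V) : g \notin R -> \dim (R + <[g]>) = (\dim R).+1.
Proof.
move=> gR; have g0 : g != 0 by apply: contraNneq gR => ->; rewrite mem0v.
rewrite dimv_disjoint_sum ?dim_vline ?g0 ?addn1 //.
apply/eqP; rewrite -subv0; apply/subvP => u; rewrite memv_cap => /andP[uR /vlineP[k uE]].
rewrite memv0; case: (eqVneq k 0) uE uR => [-> ->|k0 ->]; first by rewrite scale0r.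
by move=> /(memvZ k^-1); rewrite scalerK // (negPf gR).
Qed.

(** A basis of a complement of R in U, which can be made to start with any given
    vector g of U outside R. *)
Lemma relative_basis R U (g : V) : (R <= U)%VS ->
  exists s : seq V, [/\ size s = (\dim U - \dim R)%N, (<<s>> + R = U)%VS &
    g \in U -> g \notin R -> nth 0 s 0 = g].
Proof.
move=> RU; have [/andP[gU gR]|gN] := boolP ((g \in U) && (g \notin R)).
  have RgU : (R + <[g]> <= U)%VS by rewrite subv_add RU -memvE.
  exists (g :: vbasis (U :\: (R + <[g]>))); split=> //=.
    rewrite size_tuple; have := dimv_cap_compl U (R + <[g]>).
    by rewrite (capv_idPr RgU) dim_add_line //; lia.
  rewrite span_cons (span_basis (vbasisP _)) addvC addvA addvC.
  by rewrite addv_diff (addv_idPl RgU).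
exists (vbasis (U :\: R)); split=> [||gU gR]; last by rewrite gU gR in gN.
  by rewrite size_tuple; have := dimv_cap_compl U R; rewrite (capv_idPr RU); lia.
by rewrite (span_basis (vbasisP _)) addv_diff (addv_idPl RU).
Qed.

End SubspaceLemmas.

Section AdaptedBasis.
Variables (F : finFieldType) (n d : nat) (f f' : flag F n d) (w : 'rV[F]_d).
Hypothesis n_gt0 : (0 < n)%N.
Implicit Types (g : {ffun 'I_n * 'I_n -> 'rV[F]_d}) (u : 'rV[F]_d).
Implicit Types x y : 'I_n * 'I_n.
Local Notation I := ('I_n * 'I_n)%type.
Local Notation X i j := (flag_at f i :&: flag_at f' j)%VS.
Local Notation cell x := (X x.1.+1 x.2.+1).
Local Notation below x := (X x.1 x.2.+1 + X x.1.+1 x.2)%VS.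

Lemma cellS i i' j j' : (i <= i')%N -> (j <= j')%N -> (X i j <= X i' j')%VS.
Proof. by move=> ii' jj'; apply: capvS; apply: flag_at_homo. Qed.

Lemma below_subv (x : I) : (below x <= cell x)%VS.
Proof. by rewrite subv_add !cellS. Qed.

(** The two lower neighbours of a cell meet in its diagonal neighbour, which
    makes the dimensions of the cells satisfy the recurrence of corner sums. *)
Lemma dim_below (x : I) :
  (\dim (below x) + \dim (X x.1 x.2) = \dim (X x.1 x.2.+1) + \dim (X x.1.+1 x.2))%N.
Proof.
rewrite -[RHS]dimv_sum_cap; congr (_ + _)%N; congr (\dim _).
apply/eqP; rewrite eqEsubv; apply/andP; split.
  by rewrite subv_cap !cellS.
rewrite subv_cap (subv_trans (capvSl _ _) (capvSl _ _)).
exact: subv_trans (capvSr _ _) (capvSr _ _).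
Qed.

(** The base 3 makes a term cost more than two terms one step lower. *)
Definition weight (g : {ffun I -> 'rV[F]_d}) : nat :=
  \sum_(x : I) (g x != 0%R) * 3 ^ (x.1 + x.2).

Definition cell_sum (g : {ffun I -> 'rV[F]_d}) : bool :=
  [forall x, g x \in cell x] && (\sum_x g x == w).

Lemma cell_sum_exists : exists g, cell_sum g.
Proof.
have ltn : (n.-1 < n)%N by rewrite prednK.
exists [ffun x => if x == (Ordinal ltn, Ordinal ltn) then w else 0].
apply/andP; split; last first.
  by under eq_bigr do rewrite ffunE; rewrite -big_mkcond big_pred1_eq.
apply/forallP => x; rewrite ffunE; case: eqP => [->|_]; last exact: mem0v.
by rewrite !flag_at_full /= ?prednK // capvv memvf.
Qed.

Definition drop_at (g : {ffun I -> 'rV[F]_d}) (x : I) : {ffun I -> 'rV[F]_d} :=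
  [ffun z => if z == x then 0 else g z].
Definition add_at (g : {ffun I -> 'rV[F]_d}) (y : I) u : {ffun I -> 'rV[F]_d} :=
  [ffun z => g z + if z == y then u else 0].

Lemma sum_drop_at g x : \sum_z drop_at g x z = \sum_z g z - g x.
Proof.
rewrite (bigD1 x) //= [in RHS](bigD1 x) //= ffunE eqxx add0r addrAC subrr add0r.
by apply: eq_bigr => z zx; rewrite ffunE (negPf zx).
Qed.

Lemma sum_add_at g y u : \sum_z add_at g y u z = \sum_z g z + u.
Proof.
under eq_bigr do rewrite ffunE.
by rewrite big_split /= -big_mkcond big_pred1_eq.
Qed.

Lemma weight_drop_at g x : g x != 0 ->
  weight g = (weight (drop_at g x) + 3 ^ (x.1 + x.2))%N.
Proof.
move=> gx; rewrite /weight (bigD1 x) //= [in RHS](bigD1 x) //= ffunE !eqxx gx.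
rewrite mul1n mul0n add0n addnC; congr (_ + _)%N.
by apply: eq_bigr => z zx; rewrite ffunE (negPf zx).
Qed.

Lemma weight_add_at g y u :
  (weight (add_at g y u) <= weight g + (u != 0%R) * 3 ^ (y.1 + y.2))%N.
Proof.
have -> : ((u != 0%R) * 3 ^ (y.1 + y.2) =
    \sum_z if z == y then (u != 0%R) * 3 ^ (z.1 + z.2) else 0)%N.
  by rewrite -big_mkcond big_pred1_eq.
rewrite /weight -big_split; apply: leq_sum => z _ /=; rewrite ffunE.
case: (z =P y) => _; last by rewrite addr0 addn0.
rewrite -mulnDl leq_mul2r; apply/orP; right.
case: (eqVneq u 0) => [->|_]; first by rewrite addr0 addn0.
by rewrite addn1; case: (_ != _).
Qed.

Lemma weight_absorb g y u : g y != 0 -> (weight (add_at g y u) <= weight g)%N.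
Proof.
move=> gy; apply: leq_sum => z _; rewrite ffunE.
by case: (z =P y) => [->|_]; rewrite ?addr0 // gy leq_mul2r leq_b1 orbT.
Qed.

(** A vector on the border i = 0 or j = 0 is zero and may be placed in any cell. *)
Lemma corner_vector_cell i j u : (i <= n)%N -> (j <= n)%N -> u \in X i j ->
  exists2 y : I, u \in cell y & u != 0 -> (y.1 + y.2).+2 = (i + j)%N.
Proof.
case: i => [|i] iN.
  rewrite flag_at0 cap0v memv0 => _ /eqP ->; exists (Ordinal n_gt0, Ordinal n_gt0).
    exact: mem0v.
  by rewrite eqxx.
case: j => [|j] jN.
  rewrite flag_at0 capv0 memv0 => /eqP ->; exists (Ordinal n_gt0, Ordinal n_gt0).
    exact: mem0v.
  by rewrite eqxx.
by exists (Ordinal iN, Ordinal jN) => //= _; lia.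
Qed.

(** Among all ways of writing w as a sum of vectors of the cells, one of minimal
    weight has support an antichain, and its terms are nonzero modulo the
    lower cells: two comparable terms could be merged, and a term in the lower
    cells could be replaced by two terms of one third of its weight. *)
Lemma minimal_cell_sum : exists g : {ffun I -> 'rV[F]_d},
  [/\ \sum_x g x = w, forall x, g x \in cell x,
      forall x, g x != 0 -> g x \notin below x
    & forall x y, g x != 0 -> g y != 0 -> (x.1 <= y.1)%N -> (x.2 <= y.2)%N -> x = y].
Proof.
have [g0 g0P] := cell_sum_exists.
case: (arg_minnP weight g0P) => g /andP[/forallP gX /eqP gw] gmin.
have valid (h : {ffun I -> 'rV[F]_d}) : (forall x, h x \in cell x) -> \sum_x h x = w -> (weight g <= weight h)%N.
  by move=> hX hw; apply/gmin/andP; split; [apply/forallP | apply/eqP].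
have dropX x z : drop_at g x z \in cell z by rewrite ffunE; case: eqP; rewrite ?mem0v.
have addX (h : {ffun I -> 'rV[F]_d}) y u : (forall z, h z \in cell z) -> u \in cell y ->
    forall z, add_at h y u z \in cell z.
  move=> hX uX z; rewrite ffunE; apply: rpredD => //.
  by case: eqP => [->|]; rewrite ?mem0v.
exists g; split=> // [x gx|x y gx gy xy1 xy2].
  apply/negP => /memv_addP[a aX [b bX gE]].
  (* Replace g x = a + b by the terms a and b, placed in the two lower cells. *)
  have [ya yaX wa] := corner_vector_cell (ltnW (ltn_ord x.1)) (ltn_ord x.2) aX.
  have [yb ybX wb] := corner_vector_cell (ltn_ord x.1) (ltnW (ltn_ord x.2)) bX.
  have := valid (add_at (add_at (drop_at g x) ya a) yb b).
  rewrite !sum_add_at sum_drop_at gw -addrA -gE subrK => /(_ _ erefl) vv.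
  have {}vv := vv (addX _ _ _ (addX _ _ _ (dropX x) yaX) ybX).
  have := weight_add_at (add_at (drop_at g x) ya a) yb b.
  have := weight_add_at (drop_at g x) ya a.
  have := weight_drop_at gx.
  have bound u (y : I) : (u != 0 -> (y.1 + y.2).+1 = (x.1 + x.2)%N) ->
      (3 * ((u != 0%R :> 'rV[F]_d) * 3 ^ (y.1 + y.2)) <= 3 ^ (x.1 + x.2))%N.
    case: (u != 0) => [/(_ isT) yx|_]; last by rewrite mul0n muln0.
    by rewrite mul1n -expnS yx.
  have /bound : a != 0 -> (ya.1 + ya.2).+1 = (x.1 + x.2)%N by move/wa; lia.
  have /bound : b != 0 -> (yb.1 + yb.2).+1 = (x.1 + x.2)%N by move/wb; lia.
  have : (0 < 3 ^ (x.1 + x.2))%N by rewrite expn_gt0.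
  by lia.
case: (eqVneq x y) => // xy.
(* Merge the term at x into the one at y. *)
have := valid (add_at (drop_at g x) y (g x)).
rewrite sum_add_at sum_drop_at gw subrK => /(_ _ erefl) vv.
have gxy : g x \in cell y by apply: subvP (gX x); apply: cellS.
have {}vv := vv (addX _ _ _ (dropX x) gxy).
have dy : drop_at g x y != 0 by rewrite ffunE ifN // eq_sym.
have := weight_absorb (g x) dy; have := weight_drop_at gx.
have : (0 < 3 ^ (x.1 + x.2))%N by rewrite expn_gt0.
by lia.
Qed.

(** The terms g x of a minimal sum become the first vectors of the blocks x in
    D, so that w is a sum of basis vectors.  The blocks together span each
    f_i \cap f'_j by induction on i + j, and they form a basis because their sizes
    add up to the dimension. *)
Lemma orbit_exists : exists x : Xi n d, in_orbit x f f' w.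
Proof.
have [g [gw gX gb gmax]] := minimal_cell_sum.
have /fin_all_exists[b bP] : forall x : I, exists s : seq 'rV[F]_d,
    [/\ size s = (\dim (cell x) - \dim (below x))%N, (<<s>> + below x = cell x)%VS &
      g x \in cell x -> g x \notin below x -> nth 0 s 0 = g x].
  by move=> x; apply: relative_basis; apply: below_subv.
pose A : 'M[nat]_n := \matrix_(i, j) size (b (i, j)).
have AE (x : I) : A x.1 x.2 = size (b x) by rewrite mxE -surjective_pairing.
pose e (x : I) (s : nat) : 'rV[F]_d := nth 0 (b x) s.-1.
have b_e (x : I) : b x = [seq e x s | s <- iota 1 (A x.1 x.2)].
  rewrite AE -[iota 1 _]/(iota (1 + 0) _) iotaDl -map_comp -[LHS](mkseq_nth 0); exact: eq_map.
have e_b (x : I) s : (0 < s <= A x.1 x.2)%N -> e x s \in b x.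
  by move=> sA; rewrite b_e; apply: map_f; rewrite mem_iota add1n ltnS.
have b_cell x : (<<b x>> <= cell x)%VS by have [_ <- _] := bP x; apply: addvSl.
have spanX i j : (i <= n)%N -> (j <= n)%N ->
    <<block_seq A e (fun x => (x.1 < i) && (x.2 < j))%N>>%VS = X i j.
  move=> iN jN; apply/eqP; rewrite eqEsubv; apply/andP; split.
    apply: block_span_subv => x s /andP[xi xj] /e_b/memv_span/(subvP (b_cell x)).
    by apply: subvP; apply: cellS.
  elim: {i j}(i + j)%N {-2}i {-2}j (erefl (i + j)%N) iN jN => [|k IH] [|i] [|j] //=;
    rewrite ?flag_at0 ?cap0v ?capv0 ?sub0v // => ijk iN jN.
  pose x : I := (Ordinal iN, Ordinal jN); have [_ <- _] := bP x.
  rewrite 2!subv_add; apply/and3P; split.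
  - apply/span_subvP => u; rewrite b_e => /mapP[s]; rewrite mem_iota add1n ltnS.
    by move=> sA ->; apply/memv_span/mem_block_seq; rewrite //= !ltnSn.
  - apply: subv_trans (IH i j.+1 _ _ _) _; try lia.
    by apply: block_spanS => y; lia.
  - apply: subv_trans (IH i.+1 j _ _ _) _; try lia.
    by apply: block_spanS => y; lia.
have cornerA i j : (i <= n)%N -> (j <= n)%N -> corner A i j = \dim (X i j).
  elim: {i j}(i + j)%N {-2}i {-2}j (leqnn (i + j)%N) => [|k IH] [|i] [|j] //=;
    rewrite ?flag_at0 ?cap0v ?capv0 ?dimv0 ?corner0l ?corner0r // => ijk iN jN.
  pose x : I := (Ordinal iN, Ordinal jN).
  have := cornerS A (Ordinal iN) (Ordinal jN); rewrite /= (IH i j) ?(IH i.+1 j) ?(IH i j.+1); try lia.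
  have := dim_below x; have := dimvS (below_subv x); have := AE x.
  by have [-> _ _] := bP x; rewrite /=; lia.
have eB : basis_of fullv (block_seq A e predT).
  have fullE : <<block_seq A e predT>>%VS = fullv.
    rewrite (@eq_block_seq _ _ _ _ _ _ (fun x => (x.1 < n) && (x.2 < n))%N).
      by rewrite spanX // !flag_at_full // capvv.
    by move=> x; rewrite !ltn_ord.
  rewrite basisEdim fullE subvv /= size_block_seq.
  rewrite (eq_bigl (fun x => (x.1 < n) && (x.2 < n))%N) => [|x]; last first.
    by rewrite !ltn_ord.
  by rewrite -/(corner A n n) cornerA // !flag_at_full // capvv.
pose D := [set x | g x != 0].
have g_e x : x \in D -> (0 < A x.1 x.2)%N /\ e x 1%N = g x.
  rewrite inE => gx; have [_ _ /(_ (gX x) (gb x gx)) gE] := bP x.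
  split=> //; rewrite AE lt0n; apply: contraNneq gx.
  by move=> /size0nil bx; rewrite -gE bx.
have AD : decorated d A D.
  apply/decoratedE; split.
  - by rewrite cornerA // !flag_at_full // capvv dimvf /dim /= mul1n.
  - move=> x y; rewrite !inE => gx gy; split=> xy1.
      rewrite ltnNge; apply/negP => xy2.
      by have xy := gmax x y gx gy (ltnW xy1) xy2; rewrite xy ltnn in xy1.
    have [xy2|/ltnW yx2] := leqP x.2 y.2; first by apply: gmax; rewrite ?xy1.
    by symmetry; apply: gmax; rewrite ?xy1.
  - by move=> x /g_e[].
exists (XiOf (Xi_val := (A, D)) AD), e; split=> //= [i|j|].
- rewrite -flag_atE -[LHS]capvf -(flag_at_full f' (leqnn n)) -spanX //.
    by congr <<_>>%VS; apply: eq_block_seq => x /=; rewrite ltn_ord andbT.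
  by rewrite -ltnS.
- rewrite -flag_atE -[LHS]capfv -(flag_at_full f (leqnn n)) -spanX //.
    by congr <<_>>%VS; apply: eq_block_seq => x /=; rewrite ltn_ord.
  by rewrite -ltnS.
rewrite -gw (bigID (mem D)) /= [Z in _ + Z]big1 ?addr0 => [|x]; last first.
  by rewrite inE negbK => /eqP.
by apply: eq_bigr => x /g_e[].
Qed.

End AdaptedBasis.

(** Invariants determine the orbit: a triple lies in some orbit, whose decorated
    matrix is then forced. *)
Lemma in_orbitE (F : finFieldType) n d (x : Xi n d) (f f' : flag F n d) w :
  (0 < n)%N ->
  in_orbit x f f' w <-> has_position (val x).1 (val x).2 f f' w.
Proof.
move=> n_gt0; split; first exact: in_orbit_has_position.
move=> xP; have [y yO] := orbit_exists f f' w n_gt0.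
by rewrite -(has_position_inj (in_orbit_has_position yO) xP).
Qed.

(** * Structure constants as numbers of flags *)

Section OrbitNonempty.
Variables (F : finFieldType) (n d : nat) (z : Xi n d).
Local Notation A := (val z).1.
Local Notation D := (val z).2.

Let labels : seq ('I_n * 'I_n * nat) :=
  [seq (x, s) | x <- enum (predT : pred ('I_n * 'I_n)), s <- iota 1 (A x.1 x.2)].
Let e (x : 'I_n * 'I_n) (s : nat) : 'rV[F]_d :=
  nth 0 (vbasis fullv) (index (x, s) labels).

Lemma block_seq_standard_basis : block_seq A e predT = vbasis fullv.
Proof.
have sizeL : size labels = \dim (fullv : {vspace 'rV[F]_d}).
  rewrite size_allpairs_dep sumnE big_map big_enum /= dimvf /dim /= mul1n.
  have /decoratedE[dE _ _] := Xi_decorated z; rewrite -[RHS]dE.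
  by apply: eq_big => x; rewrite ?ltn_ord // size_iota.
have uL : uniq labels.
  apply: allpairs_uniq_dep => [|x _|[x s] [y t] _ _ /= [-> ->] //].
    exact: enum_uniq.
  exact: iota_uniq.
have -> : block_seq A e predT = [seq e p.1 p.2 | p <- labels].
  by rewrite /block_seq /labels map_allpairs.
apply: (@eq_from_nth _ 0) => [|i]; rewrite size_map ?sizeL ?size_tuple // => iL.
have x0 : 'I_n * 'I_n * nat by case: labels sizeL iL => [<-|].
by rewrite (nth_map x0) ?sizeL // /e -surjective_pairing index_uniq ?sizeL.
Qed.

Lemma block_flag (k : 'I_n * 'I_n -> 'I_n) :
  is_flag [ffun i : 'I_n.+1 => <<block_seq A e [pred x | lbl (k x) <= i]%N>>%VS].
Proof.
apply/and3P; split.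
- rewrite ffunE (@eq_block_seq _ _ _ _ _ _ pred0) //.
  by rewrite /block_seq enum0 span_nil.
- rewrite ffunE (@eq_block_seq _ _ _ _ _ _ predT) => [|x]; last by rewrite /= ltn_ord.
  by rewrite block_seq_standard_basis (span_basis (vbasisP _)).
- apply/forallP => i; rewrite !ffunE; apply: block_spanS => x /=.
  by move=> h; apply: leq_trans h _; rewrite /bump leq_addl.
Qed.

(** Label the standard basis by the positions of the matrix, with multiplicity,
    and let the rows and the columns define the two flags. *)
Lemma orbit_nonempty : exists (f f' : flag F n d) w, in_orbit z f f' w.
Proof.
exists (Flag (block_flag fst)), (Flag (block_flag snd)), (\sum_(x in D) e x 1%N), e.
split=> // [|i|j]; rewrite ?ffunE //.
by rewrite block_seq_standard_basis vbasisP.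
Qed.

End OrbitNonempty.

Lemma sum_orbit_char (F : finFieldType) n d (z : Xi n d) (f f' : flag F n d) w
    (a : Xi n d -> algC) : in_orbit z f f' w ->
  \sum_y a y * orbit_char y f f' w = a z.
Proof.
move=> zO; rewrite (bigD1 z) //= big1 ?addr0 => [|y yz]; rewrite /orbit_char.
  by rewrite asboolT // mulr1.
rewrite asboolF ?mulr0 // => yO; case/eqP: yz.
exact: has_position_inj (in_orbit_has_position yO) (in_orbit_has_position zO).
Qed.

(** Evaluating on a triple of a given orbit isolates one coefficient. *)
Lemma struct_const_eq n d (x y : Xi n d) (c : MS n d) :
  is_struct_const x y c -> struct_const x y = c.
Proof.
move=> cP; rewrite /struct_const; case: classical_sets.xgetP => [c' _ c'P|/(_ c)//].
apply/ffunP => z; apply: laurent_ev_prime_inj => p pp.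
have [f [f' [w zO]]] := orbit_nonempty 'F_p z.
have := cP _ f f' w; rewrite c'P !(sum_orbit_char _ zO).
by rewrite card_Fp.
Qed.

(** Holds also when (M, D) is not a decorated matrix: then both sides vanish. *)
Lemma ebasE n d (M : 'M[int]_n) (D : {set 'I_n * 'I_n}) (z : Xi n d) :
  ebas d M D z = ((map_mx Posz (val z).1 == M) && ((val z).2 == D))%:R.
Proof.
rewrite /ebas; case: pickP => [x /andP[/eqP xM /eqP xD]|no]; last first.
  by rewrite no ffunE.
rewrite ffunE; congr (nat_of_bool _)%:R; apply/eqP/andP => [->|[/eqP zM /eqP zD]].
  by rewrite xM xD.
apply: val_inj; rewrite [LHS]surjective_pairing [RHS]surjective_pairing zD xD.
congr (_, _); apply/matrixP => i j.
by have /matrixP/(_ i j) := etrans zM (esym xM); rewrite !mxE => -[].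
Qed.

Lemma MS_mul_ebas n d (x y : Xi n d) :
  MS_mul (ebas d (map_mx Posz (val x).1) (val x).2)
         (ebas d (map_mx Posz (val y).1) (val y).2) = struct_const x y.
Proof.
have ebas1 (z z' : Xi n d) :
    ebas d (map_mx Posz (val z).1) (val z).2 z' = (z' == z)%:R.
  rewrite ebasE; congr (nat_of_bool _)%:R; apply/andP/eqP => [[/eqP zM /eqP zD]|->//].
  apply: val_inj; rewrite [LHS]surjective_pairing [RHS]surjective_pairing zD.
  congr (_, _); apply/matrixP => i j.
  by have /matrixP/(_ i j) := zM; rewrite !mxE => -[].
rewrite /MS_mul (bigD1 x) //= (bigD1 y) //= !ebas1 !eqxx mulr1 scale1r.
rewrite !big1 ?addr0 // => [z zx|z zy]; last by rewrite !ebas1 (negPf zy) mulr0 scale0r.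
by rewrite big1 // => z' _; rewrite ebas1 (negPf zx) mul0r scale0r.
Qed.

(** An undecorated first factor only sees the vector 0. *)
Lemma conv_undecorated (F : finFieldType) n d (x y : Xi n d) (f f' : flag F n d) w :
  (val x).2 = set0 ->
  conv (orbit_char x) (orbit_char y) f f' w =
  #|[set g : flag F n d | `[< in_orbit x f g 0 >] && `[< in_orbit y g f' w >]]|%:R.
Proof.
move=> x0; rewrite /conv -sum1_card natr_sum.
rewrite [RHS]big_mkcond; apply: eq_bigr => g _ /=; rewrite inE.
rewrite (bigD1 0) //= subr0 big1 ?addr0 => [|mu mu0].
  by rewrite /orbit_char; case: `[< _ >]; case: `[< _ >]; rewrite ?mulr1 ?mulr0.
rewrite /orbit_char asboolF ?mul0r // => -[e [_ _ _]].
by rewrite x0 big_set0 => /eqP; rewrite (negPf mu0).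
Qed.

(** Every triple lies in an orbit, so it is enough to count the intermediate
    flags of the triples of each orbit. *)
Lemma MS_mul_count n d (x y : Xi n d) (c : MS n d) : (0 < n)%N ->
  (val x).2 = set0 ->
  (forall (F : finFieldType) (f f' : flag F n d) w z, in_orbit z f f' w ->
     #|[set g : flag F n d | `[< in_orbit x f g 0 >] && `[< in_orbit y g f' w >]]|%:R
     = laurent_ev (sqrtC #|F|%:R) (c z)) ->
  MS_mul (ebas d (map_mx Posz (val x).1) (val x).2)
         (ebas d (map_mx Posz (val y).1) (val y).2) = c.
Proof.
move=> n_gt0 x0 cP; rewrite MS_mul_ebas; apply: struct_const_eq => F f f' w.
have [z zO] := orbit_exists f f' w n_gt0.
by rewrite conv_undecorated // (cP _ _ _ _ _ zO) (sum_orbit_char _ zO).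
Qed.

(** * Counting lines that catch a vector *)

Section LineCounting.
Variables (F : finFieldType) (d : nat).
Local Notation V := 'rV[F]_d.
Local Notation q := #|F|.
Implicit Types U T W K Y : {vspace V}.

(** The lines of T / U, as subspaces of V. *)
Definition line_between U T : {set {vspace V}} :=
  [set Y : {vspace V} | [&& (U <= Y)%VS, (Y <= T)%VS & \dim Y == (\dim U).+1]].

(** Passing from U to Y adds at most one dimension to the sum with K; which of
    the sum and the intersection grows is decided by Y <= U + K. *)
Lemma dim_lineD U T Y K : Y \in line_between U T ->
  \dim (Y + K) = (\dim (U + K) + ~~ (Y <= U + K)%VS)%N.
Proof.
rewrite inE => /and3P[UY _ /eqP dY].
have [YK|YK] := boolP (Y <= U + K)%VS.
  rewrite addn0; congr (\dim _); apply/eqP.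
  by rewrite eqEsubv subv_add YK addvSr addvS.
have UK : (U + K <= Y + K)%VS by apply: addvS.
have UKltn : (\dim (U + K) < \dim (Y + K))%N.
  by rewrite (ltn_leqif (dimv_leqif_sup UK)) subv_add addvSr andbT.
have := dimv_sum_cap Y K; have := dimv_sum_cap U K.
by have := dimvS (capvS UY (subvv K)); rewrite /= addn1; lia.
Qed.

Lemma dim_line_cap U T Y K : Y \in line_between U T ->
  \dim (Y :&: K) = (\dim (U :&: K) + (Y <= U + K)%VS)%N.
Proof.
move=> YP; have := dim_lineD K YP; move: YP; rewrite inE => /and3P[_ _ /eqP dY].
have := dimv_sum_cap Y K; have := dimv_sum_cap U K.
by case: (Y <= _)%VS; lia.
Qed.

Lemma line_add U T Y x : Y \in line_between U T -> x \in Y -> x \notin U ->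
  (U + <[x]>)%VS = Y.
Proof.
rewrite inE => /and3P[UY _ /eqP dY] xY xU; apply/eqP.
by rewrite eqEdim subv_add UY -memvE xY dim_add_line // dY leqnn.
Qed.

(** Each vector of T outside K spans with U exactly one of the lines counted
    here, and each such line arises from its vectors outside U. *)
Lemma card_line_between U K T : (U <= K)%VS -> (K <= T)%VS ->
  (#|[set Y in line_between U T | ~~ (Y <= K)%VS]| * (q ^ (\dim U).+1 - q ^ \dim U)
   = q ^ \dim T - q ^ \dim K)%N.
Proof.
move=> UK KT; have card_vs (W : {vspace V}) : #|[set x : V | x \in W]| = (q ^ \dim W)%N.
  by rewrite cardsE; apply: card_vspace.
have card_diff (W W' : {vspace V}) : (W' <= W)%VS ->
    #|[set x : V | (x \in W) && (x \notin W')]| = (q ^ \dim W - q ^ \dim W')%N.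
  move=> W'W; rewrite -!card_vs -(cardsID [set x : V | x \in W'] [set x | x \in W]).
  have -> : [set x | x \in W] :&: [set x | x \in W'] = [set x | x \in W'].
    by apply/setP => x; rewrite !inE andb_idl //; apply: subvP.
  rewrite addKn; congr #|pred_of_set _|; apply/setP => x; rewrite !inE andbC //.
rewrite -[RHS]card_diff // -[RHS]sum1_card.
rewrite [RHS](partition_big (fun x : V => U + <[x]>)%VS
  (fun Y => Y \in [set Y in line_between U T | ~~ (Y <= K)%VS])) => [|x] /=.
  rewrite -sum_nat_const; apply: eq_bigr => Y; rewrite inE => /andP[YP YK].
  have := YP; rewrite inE => /and3P[UY YT /eqP dY].
  rewrite -dY -card_diff // -sum1_card; apply: eq_bigl => x; rewrite !inE.
  apply/andP/andP => [[xY xU]|[/andP[xT xK] /eqP xY]].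
    rewrite (line_add YP xY xU) eqxx (subvP YT) //=; split=> //.
    apply: contra YK => xK; rewrite -(line_add YP xY xU) subv_add UK.
    by rewrite -memvE.
  split; first by rewrite -xY memvE addvSr.
  by apply: contra xK; apply: subvP.
rewrite !inE => /andP[xT xK].
have xU : x \notin U by apply: contra xK; apply: subvP.
rewrite addvSl subv_add (subv_trans UK KT) -memvE xT dim_add_line // eqxx /=.
by apply: contra xK; rewrite subv_add -!memvE => /andP[].
Qed.

Lemma card_line_between_rel U K T : (U <= K)%VS -> (K <= T)%VS ->
  (#|[set Y in line_between U T | ~~ (Y <= K)%VS]| * (q - 1)
   = q ^ (\dim T - \dim U) - q ^ (\dim K - \dim U))%N.
Proof.
move=> UK KT; apply/eqP; have q0 : (0 < q ^ \dim U)%N.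
  by rewrite expn_gt0 (cardD1 0).
rewrite -(eqn_pmul2r q0) -mulnA !mulnBl mul1n -expnS card_line_between //.
by rewrite -!expnD !subnK // dimvS // (subv_trans UK).
Qed.

End LineCounting.

(** In the application U = f_h, T = f_{h+1} and G = f', while t and r are the
    reaches of w at h and h + 1. *)
Section LinesCatchingVector.
Variables (F : finFieldType) (d : nat).
Local Notation V := 'rV[F]_d.
Local Notation q := #|F|.
Variables (U T : {vspace V}) (G : nat -> {vspace V}) (w : V) (t r : nat).
Hypothesis UT : (U <= T)%VS.
Hypothesis G_homo : forall i j, (i <= j)%N -> (G i <= G j)%VS.
Hypothesis tP : forall j, (w \in U + G j)%VS = (t <= j)%N.
Hypothesis rP : forall j, (w \in T + G j)%VS = (r <= j)%N.

Definition layer (j : nat) : {vspace V} := ((U + G j) :&: T)%VS.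
(** In the application, the sum of the entries of B in row h + 1 and the columns
    up to j. *)
Definition layer_dim (j : nat) : nat := (\dim (layer j) - \dim U)%N.
(** The lines whose position is the column of index p, that is of label p + 1. *)
Definition lines_at (p : nat) : {set {vspace V}} :=
  [set Y in line_between U T | (Y <= U + G p.+1)%VS && ~~ (Y <= U + G p)%VS].

Lemma layer_homo i j : (i <= j)%N -> (layer i <= layer j)%VS.
Proof. by move=> ij; apply/capvS/subvv/addvS/G_homo. Qed.

Lemma sub_layer j : (U <= layer j)%VS.
Proof. by rewrite subv_cap addvSl UT. Qed.

Lemma card_lines_at p :
  (#|lines_at p| * (q - 1) = q ^ layer_dim p.+1 - q ^ layer_dim p)%N.
Proof.
rewrite -card_line_between_rel ?sub_layer ?layer_homo //.
congr (#|pred_of_set _| * _)%N; apply/setP => Y; rewrite !inE !subv_cap.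
by case: (Y <= T)%VS; case: (Y <= U + G p.+1)%VS;
  case: (U <= Y)%VS; rewrite ?andbF ?andbT.
Qed.

Section BelowT.
Variables (j : nat).
Hypotheses (rj : (r <= j)%N) (jt : (j < t)%N).

Lemma layer_shift : exists2 x : V, x \in T & (w - x)%R \in G j.
Proof.
have : w \in (T + G j)%VS by rewrite rP.
by case/memv_addP => x xT [y yG ->]; exists x; rewrite // addrC addKr.
Qed.

Lemma mem_shift (x : V) W : w - x \in G j -> (w \in W + G j)%VS = (x \in W + G j)%VS.
Proof.
move=> wx; have wx' : w - x \in (W + G j)%VS by apply: (subvP (addvSr _ _)).
by rewrite -(subrK x w) rpredDl.
Qed.

(** Here x represents w modulo G j.  As x lies in T but not in U + G j, the only
    way for Y <= T to catch it is to add to the layer j the direction of x. *)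
Lemma line_catches (x : V) Y : x \in T -> w - x \in G j -> Y \in line_between U T ->
  (w \in Y + G j)%VS = (Y <= layer j + <[x]>)%VS && ~~ (Y <= layer j)%VS.
Proof.
move=> xT wx YP; rewrite (mem_shift _ wx).
have xU : x \notin (U + G j)%VS by rewrite -(mem_shift _ wx) tP -ltnNge.
have xL : x \notin layer j by rewrite memv_cap xT andbT.
have := YP; rewrite inE => /and3P[UY YT dY].
apply/idP/andP => [xY|[YL YnL]].
  have YU : ~~ (Y <= U + G j)%VS.
    apply: contra xU => YU; apply: subvP xY.
    by rewrite subv_add YU addvSr.
  have YnL : ~~ (Y <= layer j)%VS by rewrite subv_cap YT andbT.
  split=> //; apply: subv_trans (addvSl Y (layer j)) _.
  rewrite -(geq_leqif (dimv_leqif_sup _)).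
    have := dim_lineD (layer j) YP; rewrite (addv_idPr (sub_layer j)) YnL => ->.
    by rewrite dim_add_line // addn1.
  rewrite subv_add addvSr -memvE.
  have : x \in ((Y + G j) :&: T)%VS by rewrite memv_cap xY.
  rewrite -vspace_modl //; apply: subvP; apply: addvS => //.
  by rewrite subv_cap capvSr (subv_trans (capvSl _ _) (addvSr _ _)).
have [y yY yL] : exists2 y, y \in Y & y \notin layer j by apply/subvPn.
have /memv_addP[k kL [_ /vlineP[c ->] yE]] := subvP YL _ yY.
have c0 : c != 0 by apply: contraNneq yL => c0; rewrite yE c0 scale0r addr0.
have -> : x = c^-1 *: (y - k) by rewrite yE addrC addKr scalerK.
apply/rpredZ/rpredB; first by apply: (subvP (addvSl _ _)).
by apply: subvP kL; apply: subv_trans (capvSl _ _) _; apply: addvS.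
Qed.

(** The position of x is t, since w is in U + G t but not in U + G (t - 1); adding
    vectors of the layer j < t does not change it. *)
Lemma line_catches_position Y i : Y \in line_between U T -> (w \in Y + G j)%VS ->
  (Y <= U + G i)%VS = (t <= i)%N.
Proof.
move=> YP wY; have [x xT wx] := layer_shift; apply/idP/idP => [Yi|ti].
  rewrite leqNgt; apply/negP => it.
  (* Y <= U + G i and w in Y + G j would put w in U + G k for some k < t. *)
  suff : (w \in U + G (maxn i j))%VS by rewrite tP; lia.
  apply: subvP wY; rewrite subv_add (subv_trans Yi) /=.
    by apply: subv_trans (addvSr _ _); apply: G_homo; lia.
  by apply: addvS => //; apply: G_homo; lia.
move: wY; rewrite (line_catches xT wx YP) => /andP[YL _]; apply: subv_trans YL _.
rewrite subv_add (subv_trans (capvSl _ _)) ?addvS ?G_homo //; last by lia.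
rewrite -memvE -(subKr w x); apply: rpredB; first by rewrite tP.
by apply: (subvP (addvSr _ _)); apply: subvP wx; apply: G_homo; lia.
Qed.

(** By [line_catches] these are the lines of a space one dimension above the
    layer j that avoid the layer: an affine space of dimension [layer_dim j]. *)
Lemma card_lines_catching p :
  #|[set Y in lines_at p | (w \in Y + G j)%VS]| =
  (if p.+1 == t then q ^ layer_dim j else 0)%N.
Proof.
have [x xT wx] := layer_shift; case: eqP => [pt|pt]; last first.
  apply/eqP; rewrite cards_eq0 -subset0; apply/subsetP => Y.
  rewrite !inE -!andbA => /and5P[UY YT dY Yp /andP[Yp' wY]].
  have YP : Y \in line_between U T by rewrite inE UY YT.
  move: Yp Yp'; rewrite !(line_catches_position _ YP wY); lia.
have xL : x \notin layer j.
  by rewrite memv_cap xT andbT -(mem_shift _ wx) tP -ltnNge.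
apply/eqP; rewrite -(eqn_pmul2r (_ : 0 < q - 1)%N); last by rewrite subn_gt0 finNzRing_gt1.
have := card_line_between_rel (sub_layer j) (addvSl (layer j) <[x]>%VS).
rewrite dim_add_line // subSn ?dimvS ?sub_layer // -/(layer_dim j).
rewrite expnS -[X in _ = (_ - X)%N]mul1n -mulnBl [RHS]mulnC => <-.
apply/eqP; congr (#|pred_of_set _| * _)%N; apply/setP => Y; rewrite [LHS]inE [RHS]inE.
rewrite [Y \in lines_at p]inE.
have [YP|YP] := boolP (Y \in line_between U T).
  have -> : (Y \in line_between U (layer j + <[x]>)) = (Y <= layer j + <[x]>)%VS.
    by move: YP; rewrite !inE => /and3P[-> _ ->]; rewrite andbT.
  rewrite -(line_catches xT wx YP); case wY: (_ \in _); rewrite ?andbF //.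
  by rewrite !(line_catches_position _ YP wY) pt leqnn -pt ltnn.
symmetry; apply: contraNF YP => /andP[]; rewrite !inE => /and3P[-> YL ->] _.
by rewrite andbT (subv_trans YL) // subv_add capvSr -memvE.
Qed.

End BelowT.

Definition lines_exact (p s : nat) : {set {vspace V}} :=
  [set Y in lines_at p | [forall j : 'I_s.+1, (w \in Y + G j)%VS == (s <= j)%N]].

(** Catching w modulo G j is monotone in j, so that only the conditions at s and
    s - 1 matter. *)
Lemma lines_exactE p s :
  (#|lines_exact p s| +
     (if s is s'.+1 then #|[set Y in lines_at p | (w \in Y + G s')%VS]| else 0)
   = #|[set Y in lines_at p | (w \in Y + G s)%VS]|)%N.
Proof.
have homo Y i j : (i <= j)%N -> (w \in Y + G i)%VS -> (w \in Y + G j)%VS.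
  by move=> ij; apply/subvP/addvS/G_homo.
case: s => [|s].
  rewrite addn0; apply: eq_card => Y; rewrite !inE; congr (_ && _).
  by apply/forallP/idP => [/(_ ord0)/eqP //|wY] i; rewrite [i]ord1 wY.
rewrite -(cardsID [set Y | (w \in Y + G s)%VS] [set Y in lines_at p | (w \in Y + G s.+1)%VS]).
rewrite addnC; congr addn; apply: eq_card => Y; rewrite !inE.
  by rewrite -[RHS]andbA; congr (_ && _); rewrite andb_idl //; apply: homo.
rewrite [RHS]andbC -[RHS]andbA; congr (_ && _); apply/forallP/idP.
  move=> h; rewrite andbC; have /eqP-> := h ord_max; rewrite leqnn.
  have := h (widen_ord (leqnSn _) ord_max); rewrite /= => /eqP ->.
  by rewrite ltnn.
move=> /andP[wS ws] j; have [js|js] := leqP s.+1 j.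
  by rewrite (homo _ _ _ js).
by rewrite eqbF_neg; apply: contra ws; apply: homo; rewrite -ltnS.
Qed.

Lemma card_lines_exact_eq p s : (r <= s)%N -> s = t ->
  (#|lines_exact p s| + (if (r < s) && (p.+1 == s) then q ^ layer_dim s.-1 else 0)
   = #|lines_at p|)%N.
Proof.
move=> rs st; have allw i : (t <= i)%N ->
    #|[set Y in lines_at p | (w \in Y + G i)%VS]| = #|lines_at p|.
  move=> ti; apply: eq_card => Y; rewrite [LHS]inE andb_idr //.
  rewrite !inE -!andbA => /and5P[UY _ _ _ _].
  by apply: (subvP (addvS UY (subvv _))); rewrite tP.
rewrite -(allw s) -?st // -lines_exactE; congr addn.
case: s rs st => // s rs st; have [rs'|rs'] := ltnP r s.+1.
  by rewrite card_lines_catching ?st -?st.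
rewrite andFb; apply/esym/eqP; rewrite cards_eq0 -subset0; apply/subsetP => Y.
rewrite !inE -!andbA => /and5P[UY YT _ _ /andP[_ wY]].
suff : (w \in T + G s)%VS by rewrite rP; lia.
by apply: subvP wY; apply: addvS.
Qed.

Lemma card_lines_exact_lt p s : (r <= s)%N -> (s < t)%N ->
  (#|lines_exact p s| + (if (r < s) && (p.+1 == t) then q ^ layer_dim s.-1 else 0)
   = if p.+1 == t then q ^ layer_dim s else 0)%N.
Proof.
move=> rs st; rewrite -card_lines_catching // -lines_exactE; congr addn.
case: s rs st => // s rs st; have [rs'|rs'] := ltnP r s.+1.
  by rewrite card_lines_catching // ltnW.
rewrite andFb; apply/esym/eqP; rewrite cards_eq0 -subset0; apply/subsetP => Y.
rewrite !inE -!andbA => /and5P[UY YT _ _ /andP[_ wY]].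
suff : (w \in T + G s)%VS by rewrite rP; lia.
by apply: subvP wY; apply: addvS.
Qed.

Lemma card_lines_exact_gt p s : (t < s)%N -> #|lines_exact p s| = 0%N.
Proof.
move=> ts; apply/eqP; rewrite cards_eq0 -subset0; apply/subsetP => Y.
rewrite !inE -!andbA => /and5P[UY _ _ _ /andP[_ /forallP h]].
have ts' : (t < s.+1)%N by apply: leqW.
have := h (Ordinal ts'); rewrite /= leqNgt ts /= eqbF_neg => /negP[].
by apply: (subvP (addvS UY (subvv _))); rewrite tP.
Qed.

End LinesCatchingVector.

(** * Orbits of the generators *)

Lemma corner_rows n (M : 'M[nat]_n) i :
  corner M i n = (\sum_(a < n | (a < i)%N) ro M 0%R a)%N.
Proof.
under [RHS]eq_bigr do rewrite mxE.
by rewrite pair_big_dep; apply: eq_bigl => x; rewrite ltn_ord.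
Qed.

Lemma corner_cols n (M : 'M[nat]_n) j :
  corner M n j = (\sum_(b < n | (b < j)%N) co M 0%R b)%N.
Proof.
under [RHS]eq_bigr do rewrite mxE.
rewrite (exchange_big_dep predT) //= pair_big_dep.
by apply: eq_bigl => x; rewrite ltn_ord /= ?andbT.
Qed.

Lemma corner_row n (M : 'M[nat]_n) (i : 'I_n) j :
  corner M i.+1 j = (corner M i j + \sum_(b < n | (b < j)%N) M i b)%N.
Proof.
rewrite /corner (bigID (fun x : 'I_n * 'I_n => (x.1 < i)%N)) /=; congr addn.
  by apply: eq_bigl => x; lia.
rewrite (eq_bigl (fun x : 'I_n * 'I_n => (x.1 == i) && (x.2 < j)%N)) => [|x].
  by rewrite -(pair_big_dep (pred1 i) (fun _ (b : 'I_n) => b < j)%N (fun a b => M a b)) /=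
    big_pred1_eq.
by rewrite -val_eqE /=; lia.
Qed.

Definition add_unit n (M : 'M[nat]_n) (a b : 'I_n) : 'M[nat]_n :=
  \matrix_(i, j) (M i j + ((i, j) == (a, b)))%N.

Lemma corner_add_unit n (M : 'M[nat]_n) a b i j :
  corner (add_unit M a b) i j = (corner M i j + ((a < i) && (b < j)))%N.
Proof.
rewrite /corner; under eq_bigr do rewrite mxE -surjective_pairing.
rewrite big_split /=; congr addn; rewrite -big_mkcondr /=.
have [ab|ab] := boolP ((a < i) && (b < j))%N.
  rewrite (big_pred1 (a, b)) // => x /=; rewrite andb_idl //.
  by move=> /eqP ->.
rewrite big_pred0 // => x; apply: contraNF ab => /andP[+ /eqP xE].
by rewrite xE.
Qed.

Section FlagUpdate.
Variables (F : finFieldType) (n d : nat).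

Lemma dim_corner_bounded (f f' : flag F n d) (M : 'M[nat]_n) :
  (forall i j, (i <= n)%N -> (j <= n)%N ->
     \dim (flag_at f i :&: flag_at f' j) = corner M i j) ->
  forall i j, \dim (flag_at f i :&: flag_at f' j) = corner M i j.
Proof.
move=> fM i j.
have fE (k : flag F n d) l : flag_at k l = flag_at k (minn l n).
  by rewrite /flag_at -minnA minnn.
rewrite fE (fE f') fM ?geq_minr //; apply: eq_bigl => y.
by rewrite !leq_min !ltn_ord !andbT.
Qed.

Lemma flag_update (f : flag F n d) (H : nat) (Y : {vspace 'rV[F]_d}) :
  (0 < H < n)%N -> (flag_at f H.-1 <= Y)%VS -> (Y <= flag_at f H.+1)%VS ->
  exists g : flag F n d, flag_at g H = Y /\ forall i, i != H -> flag_at g i = flag_at f i.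
Proof.
case/andP=> H0 Hn fY Yf.
pose g := [ffun i : 'I_n.+1 => if i == H :> nat then Y else flag_at f i].
have gP : is_flag g.
  apply/and3P; split.
  - by rewrite ffunE /= ltn_eqF // flag_at0.
  - by rewrite ffunE /= gtn_eqF // flag_at_full.
  - apply/forallP => i; rewrite !ffunE /= /bump /= add1n.
    case: (eqVneq (i : nat) H) => [iH|iH].
      by rewrite iH gtn_eqF.
    by case: (eqVneq i.+1 H) => [iH'|_]; [rewrite -iH' in fY | apply: flag_atS].
exists (Flag gP); have gE i : flag_at (Flag gP) i = g (inord (minn i n)) by [].
split=> [|i iH]; rewrite gE ffunE inordK; try lia.
  by rewrite (minn_idPl (ltnW Hn)) eqxx.
case: eqP => [|_]; first by lia.
by have [ni|//] := leqP n i; rewrite !flag_at_full.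
Qed.

End FlagUpdate.

Section ElementaryOrbit.
Variables (n d : nat) (h h' : 'I_n) (x : Xi n d).
Hypothesis hh' : h' = h.+1 :> nat.
Local Notation C := (val x).1.
Hypothesis x0 : (val x).2 = set0.
Hypothesis Cdiag : is_diag_mx (map_mx Posz C - delta_mx h' h).

Lemma elementary_entry (a b : 'I_n) : a != b -> C a b = ((a, b) == (h', h)).
Proof.
move=> ab; have := forallP (forallP Cdiag a) b => /implyP/(_ ab)/eqP.
rewrite !mxE xpair_eqE => /eqP; rewrite subr_eq0.
by case: (_ && _) => /eqP => -[].
Qed.

(** The only entry of C off the diagonal is just below it, so that a corner sum
    sees either whole rows or whole columns.  In terms of flags: of any two
    steps f_i and g_j, one contains the other. *)
Lemma elementary_corner i j : (i <= n)%N -> (j <= n)%N ->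
  corner C i j = if (i <= j)%N then corner C i n else corner C n j.
Proof.
move=> iN jN; rewrite /corner; have [ij|ij] := leqP i j.
  rewrite !(big_mkcond (fun x : 'I_n * 'I_n => (_ < _)%N && _)).
  apply: eq_bigr => -[a b] _ /=; rewrite ltn_ord andbT.
  case: (ltnP a i) => //= ai; case: ltnP => // jb.
  rewrite elementary_entry; last by rewrite -val_eqE /=; lia.
  by rewrite xpair_eqE -!val_eqE /=; lia.
rewrite !(big_mkcond (fun x : 'I_n * 'I_n => (_ < _)%N && _)).
apply: eq_bigr => -[a b] _ /=; rewrite ltn_ord /=.
case: (ltnP b j) => //= bj; rewrite ?andbF // ?andbT; case: ltnP => // ia.
rewrite elementary_entry; last by rewrite -val_eqE /=; lia.
by rewrite xpair_eqE -!val_eqE /=; lia.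
Qed.

Lemma elementary_corner_col j : corner C n j = (corner C j n + (j == h.+1))%N.
Proof.
have -> : (j == h.+1 : nat) =
    (\sum_(y : 'I_n * 'I_n) if y == (h', h) then (j == h.+1 : nat) else 0)%N.
  by rewrite -big_mkcond big_pred1_eq.
rewrite /corner !(big_mkcond (fun x : 'I_n * 'I_n => (_ < _)%N && _)).
rewrite -big_split; apply: eq_bigr => -[a b] _ /=; rewrite !ltn_ord /= andbT.
have [<-|ab] := eqVneq a b.
  rewrite xpair_eqE -!val_eqE /=.
  have -> : ((a == h' :> nat) && (a == h :> nat)) = false by lia.
  by rewrite addn0.
rewrite elementary_entry // xpair_eqE -!val_eqE /=.
case: (a =P h' :> nat) => [ah|_] /=; last by rewrite !if_same.
case: (b =P h :> nat) => [bh|_] /=; last by rewrite !if_same.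
by rewrite ah bh hh'; case: (ltngtP j h.+1) => jh; rewrite ?jh; lia.
Qed.

(** Equality of dimensions turns the corner sums of C into inclusions between
    steps; conversely the inclusions give back all dimensions of
    intersections. *)
Lemma elementary_orbitP (F : finFieldType) (f g : flag F n d) :
  in_orbit x f g 0 <->
  [/\ forall i, (i <= n)%N -> \dim (flag_at f i) = corner C i n,
      flag_at g h.+1 \in line_between (flag_at f h.+1) (flag_at f h.+2)
    & forall i, i != h.+1 -> flag_at g i = flag_at f i].
Proof.
have n_gt0 : (0 < n)%N by case: (h) => i; lia.
have hn : (h.+1 < n)%N by rewrite -hh'.
rewrite in_orbitE // x0; split=> [[fg _]|[df gP gf]].
  have df i : (i <= n)%N -> \dim (flag_at f i) = corner C i n.
    by move=> iN; rewrite -fg (flag_at_full g (leqnn n)) capvf.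
  have dg i : (i <= n)%N -> \dim (flag_at g i) = (corner C i n + (i == h.+1))%N.
    by move=> iN; rewrite -elementary_corner_col -fg (flag_at_full f (leqnn n)) capfv.
  have fgi i : (i <= n)%N -> (flag_at f i <= flag_at g i)%VS.
    move=> iN; apply/capv_idPl/eqP; rewrite eqEdim capvSl fg df //.
    by rewrite (elementary_corner iN iN) leqnn /= leqnn.
  split=> // [|i ih].
    rewrite inE fgi ?(ltnW hn) //= dg ?(ltnW hn) // eqxx df ?(ltnW hn) // addn1 eqxx andbT.
    apply/capv_idPr/eqP; rewrite eqEdim capvSr fg dg ?(ltnW hn) //.
    by rewrite (elementary_corner hn (ltnW hn)) ltnn elementary_corner_col eqxx leqnn.
  have [iN|/ltnW Ni] := leqP i n; last by rewrite !flag_at_full.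
  by apply/esym/eqP; rewrite eqEdim fgi // dg // (negPf ih) df // addn0 /=.
have reach0 i : reach (set0 : {set 'I_n * 'I_n}) i = 0%N.
  by apply/eqP; rewrite -leqn0; apply/reach_leP => y; rewrite inE.
have := gP; rewrite inE => /and3P[fY Yf /eqP dY].
split=> i j; last by rewrite reach0 leq0n mem0v.
move: i j; apply: dim_corner_bounded => i j iN jN.
rewrite elementary_corner //; have [->|jH] := eqVneq j h.+1.
  have [ih|ih] := leqP i h.+1.
    by rewrite (capv_idPl (subv_trans (flag_at_homo f ih) fY)) df.
  rewrite (capv_idPr (subv_trans Yf (flag_at_homo f ih))) dY df ?(ltnW hn) //.
  by rewrite elementary_corner_col eqxx addn1.
rewrite gf //; have [ij|/ltnW ji] := leqP i j.
  by rewrite (capv_idPl (flag_at_homo f ij)) df.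
by rewrite (capv_idPr (flag_at_homo f ji)) df // elementary_corner_col (negPf jH) addn0.
Qed.

End ElementaryOrbit.

(** * Intermediate flags as lines *)

Section IntermediateFlags.
Variables (n d : nat) (h h' : 'I_n) (x y z : Xi n d).
Hypothesis hh' : h' = h.+1 :> nat.
Local Notation C := (val x).1.
Local Notation A := (val y).1.
Local Notation D := (val y).2.
Local Notation B := (val z).1.
Local Notation E := (val z).2.
Variables (F : finFieldType) (f f' : flag F n d) (w : 'rV[F]_d).
Hypothesis zO : in_orbit z f f' w.
Local Notation U := (flag_at f h.+1).
Local Notation T := (flag_at f h.+2).

Definition intermediate_flags : {set flag F n d} :=
  [set g : flag F n d | `[< in_orbit x f g 0 >] && `[< in_orbit y g f' w >]].

Let n_gt0 : (0 < n)%N. Proof. by case: (h) => i; lia. Qed.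
Let hn : (h.+1 < n)%N. Proof. by rewrite -hh'. Qed.

Lemma reach_eq (D1 D2 : {set 'I_n * 'I_n}) i :
  (forall j, (reach D1 i <= j) = (reach D2 i <= j))%N -> reach D1 i = reach D2 i.
Proof. by move=> e; apply/eqP; rewrite eqn_leq e leqnn -e leqnn. Qed.

(** The dimension of Y \cap f'_j exceeds that of f_h \cap f'_j by one exactly when
    Y <= f_h + f'_j. *)
Lemma corner_line g Y : in_orbit y g f' w -> flag_at g h.+1 = Y ->
  Y \in line_between U T -> forall j,
  corner A h.+1 j = (corner B h.+1 j + (Y <= U + flag_at f' j)%VS)%N.
Proof.
move=> /in_orbit_has_position[gA _] gY YP j.
have [fB _] := in_orbit_has_position zO.
by rewrite -gA gY (dim_line_cap _ YP) fB.
Qed.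

Lemma layer_dim_row j :
  layer_dim U T (flag_at f') j = (\sum_(b < n | (b < j)%N) B h' b)%N.
Proof.
have UT : (U <= T)%VS by apply: flag_atS.
have [fB _] := in_orbit_has_position zO.
rewrite /layer_dim /layer -vspace_modl //.
have := dimv_sum_cap U (flag_at f' j :&: T).
have -> : (U :&: (flag_at f' j :&: T) = U :&: flag_at f' j)%VS.
  by rewrite [(flag_at f' j :&: T)%VS]capvC capvA (capv_idPl UT).
rewrite [(flag_at f' j :&: T)%VS]capvC !fB.
by have := corner_row B h' j; rewrite hh' => ->; lia.
Qed.

Hypothesis x0 : (val x).2 = set0.
Hypothesis Cdiag : is_diag_mx (map_mx Posz C - delta_mx h' h).

(** The corner sums of A and B at (i, j) differ only for i = h and j >= p, where p
    is the least column with Y <= f_h + f'_p.  The sums f_i + f'_j with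
    i other than h are common to f and g, which gives the equality of reaches. *)
Lemma intermediate_flags_move g : g \in intermediate_flags ->
  exists2 p, add_unit A h' p = add_unit B h p &
    forall i, i != h.+1 -> reach D i = reach E i.
Proof.
rewrite inE => /andP[/asboolP/(elementary_orbitP hh' x0 Cdiag)[_ YP gf] /asboolP yO].
have cornerY := corner_line yO erefl YP.
have [fB fE] := in_orbit_has_position zO.
have [gA gD] := in_orbit_has_position yO.
have UG i j : (i <= j)%N -> (U + flag_at f' i <= U + flag_at f' j)%VS.
  by move=> ij; apply/addvS/flag_at_homo.
have Yn : (flag_at g h.+1 <= U + flag_at f' n)%VS.
  by rewrite (flag_at_full f' (leqnn n)) addvf subvf.
have [p0 Yp0 p0min] := ex_minnP (ex_intro (fun j => flag_at g h.+1 <= U + flag_at f' j)%VS n Yn).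
have p0_gt0 : (0 < p0)%N.
  rewrite lt0n; apply/eqP => p00; move: Yp0 YP.
  rewrite p00 flag_at0 addv0 inE => YU /and3P[UY _].
  by rewrite (_ : flag_at g h.+1 = U) ?ltn_eqF //; apply/eqP; rewrite eqEsubv YU.
have pn : (p0.-1 < n)%N by rewrite prednK //; apply: p0min.
have YE j : (flag_at g h.+1 <= U + flag_at f' j)%VS = (p0.-1 < j)%N.
  rewrite prednK //; apply/idP/idP => [/p0min //|p0j].
  exact: subv_trans Yp0 (UG _ _ p0j).
exists (Ordinal pn) => [|i ih].
  apply: corner_inj => i j; rewrite !corner_add_unit /= hh'.
  have [->|ih] := eqVneq i h.+1.
    by rewrite cornerY YE ltnn ltnSn addn0.
  by rewrite -gA -fB gf //; congr (_ + (_ && _))%N; lia.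
by apply: reach_eq => j; rewrite -gD -fE gf.
Qed.

Hypothesis roco : ro A = co C.

(** A flag g is determined by its step Y.  Conversely every Y of position p with
    the right reach can be inserted in f: the remaining dimensions are those of f,
    which fit (C, 0) because the row sums of A are the column sums of C. *)
Lemma card_intermediate_flags p : add_unit A h' p = add_unit B h p ->
  (forall i, i != h.+1 -> reach D i = reach E i) ->
  #|intermediate_flags| = #|lines_exact U T (flag_at f') w p (reach D h.+1)|.
Proof.
move=> ABp DE; have [fB fE] := in_orbit_has_position zO.
have cornerAB i j : (corner A i j = corner B i j + ((i == h.+1) && (p < j)))%N.
  have := congr1 (fun M => corner M i j) ABp; rewrite !corner_add_unit hh'.
  by case: eqP; case: (p < j)%N; lia.
have UG i j : (i <= j)%N -> (U + flag_at f' i <= U + flag_at f' j)%VS.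
  by move=> ij; apply/addvS/flag_at_homo.
have dimf i : (i <= n)%N -> \dim (flag_at f i) = corner C i n.
  move=> iN; have := fB i n; rewrite (flag_at_full f' (leqnn n)) capvf => ->.
  have : corner A i n = corner C n i by rewrite corner_rows corner_cols roco.
  rewrite cornerAB (elementary_corner_col hh' Cdiag) ltn_ord andbT; lia.
have inj : {in intermediate_flags &, injective (fun g : flag F n d => flag_at g h.+1)}.
  move=> g1 g2; rewrite !inE => /andP[/asboolP/(elementary_orbitP hh' x0 Cdiag)[_ _ g1f] _].
  move=> /andP[/asboolP/(elementary_orbitP hh' x0 Cdiag)[_ _ g2f] _] g12.
  apply: flag_inj => i; have [->//|ih] := eqVneq i h.+1.
  by rewrite g1f // g2f.
rewrite -(card_in_imset inj); congr #|pred_of_set _|; apply/setP => Y.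
apply/imsetP/idP => [[g + ->]|].
  rewrite inE => /andP[/asboolP/(elementary_orbitP hh' x0 Cdiag)[_ YP gf] /asboolP yO].
  have cornerY := corner_line yO erefl YP.
  have YE j : (flag_at g h.+1 <= U + flag_at f' j)%VS = (p < j)%N.
    by have := cornerY j; rewrite cornerAB eqxx => /addnI; case: (_ <= _)%VS; case: ltnP.
  have [_ gD] := in_orbit_has_position yO.
  rewrite inE inE YP !YE ltnSn ltnn /=.
  by apply/forallP => j; rewrite gD.
rewrite inE => /andP[]; rewrite inE => /and3P[YP Yp Yp'] /forallP Yw.
have YE j : (Y <= U + flag_at f' j)%VS = (p < j)%N.
  have [pj|jp] := ltnP p j; first exact: subv_trans Yp (UG _ _ pj).
  by apply: contraNF Yp' => Yj; apply: subv_trans Yj (UG _ _ jp).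
have wE j : (w \in Y + flag_at f' j)%VS = (reach D h.+1 <= j)%N.
  have [js|/ltnW sj] := ltnP j (reach D h.+1).+1; first exact/eqP/(Yw (Ordinal js)).
  have := Yw ord_max; rewrite /= leqnn => /eqP ws.
  rewrite (subvP (addvS (subvv Y) (flag_at_homo f' (_ : reach D h.+1 <= j)%N))) //.
have := YP; rewrite inE => /and3P[UY YT _].
have [||g [gY gf]] := flag_update (f := f) (H := h.+1) (Y := Y) _ _ YT.
- by rewrite hn.
- by apply: subv_trans UY; apply: flag_atS.
exists g => //; rewrite inE; apply/andP; split; apply/asboolP.
  by apply/(elementary_orbitP hh' x0 Cdiag); rewrite gY.
apply/in_orbitE => //; split=> i j.
  rewrite cornerAB; have [->|ih] := eqVneq i h.+1; last by rewrite gf // fB addn0.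
  by rewrite gY (dim_line_cap _ YP) fB YE.
by have [->|ih] := eqVneq i h.+1; [rewrite gY wE | rewrite gf // fE DE].
Qed.

End IntermediateFlags.

(** * Coefficients of the product *)

Section Coefficients.
Variables (n d : nat) (h h' : 'I_n).
Variables (A : 'M[nat]_n) (D : {set 'I_n * 'I_n}).

Definition row_sum (j : nat) : nat := \sum_(b < n | (b < j)%N) A h' b.

(** The coefficient of e_{B,E} when B is A with a unit of column p moved from
    row h to row h + 1 and t is the reach of E at h.+1; see the counts
    [card_lines_exact_eq], [card_lines_exact_lt] and [card_lines_exact_gt]. *)
Definition move_coef (p : 'I_n) (t : nat) : laurent :=
  let s := reach D h.+1 in let r := reach D h.+2 in
  if t == s then
    v ^+ (2 * row_sum p) * qint (A h' p + 1)
    - (if (r < s)%N && (p.+1 == s) then v ^+ (2 * row_sum s.-1) else 0)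
  else if (s < t)%N && (p.+1 == t) then
    v ^+ (2 * row_sum s) - (if (r < s)%N then v ^+ (2 * row_sum s.-1) else 0)
  else 0.

Lemma row_sumS p : row_sum (p : 'I_n).+1 = (row_sum p + A h' p)%N.
Proof.
rewrite /row_sum (bigD1 p) //= addnC; congr addn.
by apply: eq_bigl => b; rewrite -val_eqE /=; lia.
Qed.

Hypothesis hh' : h' = h.+1 :> nat.

Lemma row_sum_move (B : 'M[nat]_n) p j : add_unit A h' p = add_unit B h p ->
  (\sum_(b < n | (b < j)%N) B h' b = row_sum j + (p < j))%N.
Proof.
move=> AB; have BE b : B h' b = (A h' b + (b == p))%N.
  have /matrixP/(_ h' b) := AB; rewrite !mxE !xpair_eqE eqxx /= => ->.
  by rewrite -val_eqE /= hh' gtn_eqF // addn0.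
under eq_bigr do rewrite BE.
rewrite big_split -big_mkcondr /=; congr addn.
have [pj|jp] := boolP (p < j)%N.
  by rewrite (big_pred1 p) // => b /=; rewrite andb_idl // => /eqP ->.
by rewrite big_pred0 // => b; apply: contraNF jp => /andP[+ /eqP <-].
Qed.

End Coefficients.

Lemma evm_sqrt_v2 (q k : nat) (a0 : sqrtC q%:R != 0 :> algC) :
  evm a0 (v ^+ (2 * k)) = (q ^ k)%:R.
Proof. by rewrite rmorphXn /= evm_v exprM sqrtCK natrX. Qed.

Lemma evm_sqrt_qint (q b : nat) (a0 : sqrtC q%:R != 0 :> algC) :
  (q%:R - 1) * evm a0 (qint b) = (q ^ b)%:R - 1.
Proof. by have := evm_qint a0 b; rewrite exprM sqrtCK natrX. Qed.

Section ElementaryProduct.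
Variables (n d : nat) (h h' : 'I_n) (x y : Xi n d).
Hypothesis hh' : h' = h.+1 :> nat.
Local Notation C := (val x).1.
Local Notation A := (val y).1.
Local Notation D := (val y).2.
Hypothesis x0 : (val x).2 = set0.
Hypothesis Cdiag : is_diag_mx (map_mx Posz C - delta_mx h' h).
Hypothesis roco : ro A = co C.

Lemma card_intermediate_flags_ev (z : Xi n d) (F : finFieldType) (f f' : flag F n d) w p
    (a0 : sqrtC #|F|%:R != 0 :> algC) :
  in_orbit z f f' w -> add_unit A h' p = add_unit (val z).1 h p ->
  (forall i, i != h.+1 -> reach D i = reach (val z).2 i) ->
  #|intermediate_flags x y f f' w|%:R
    = evm a0 (move_coef h h' A D p (reach (val z).2 h.+1)).
Proof.
move=> zO AB DE; have [fB fE] := in_orbit_has_position zO.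
rewrite (card_intermediate_flags hh' zO x0 Cdiag roco AB DE).
have UT := flag_atS f h.+1.
have rP j : (w \in flag_at f h.+2 + flag_at f' j)%VS = (reach D h.+2 <= j)%N.
  by rewrite fE DE // eqn_leq ltnn.
have rs : (reach D h.+2 <= reach D h.+1)%N by apply: reach_homo.
have q1 : (1 < #|F|)%N by apply: finNzRing_gt1.
have sum_lt j : (j <= p)%N ->
    layer_dim (flag_at f h.+1) (flag_at f h.+2) (flag_at f') j = row_sum h' A j.
  move=> jp; rewrite (layer_dim_row hh' zO) (row_sum_move hh' _ AB).
  by rewrite ltnNge jp addn0.
have lines : (#|lines_at (flag_at f h.+1) (flag_at f h.+2) (flag_at f') p|)%:R
    = evm a0 (v ^+ (2 * row_sum h' A p) * qint (A h' p + 1)).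
  have q10 : #|F|%:R - 1 != 0 :> algC by rewrite subr_eq0 (eqr_nat _ _ 1) gtn_eqF.
  apply: (mulfI q10); rewrite rmorphM /= mulrCA evm_sqrt_qint evm_sqrt_v2.
  rewrite -[#|F|%:R - 1](natrB _ (ltnW q1)) -natrM mulnC.
  rewrite (card_lines_at UT (@flag_at_homo _ _ _ f')) (sum_lt p) //.
  rewrite (layer_dim_row hh' zO) (row_sum_move hh' _ AB) ltnSn row_sumS.
  rewrite -addnA expnD -[X in (_ - X)%N]muln1 -mulnBr natrM natrB //.
  by rewrite expn_gt0 ltnW.
have evB u u' : evm a0 (u - u') = evm a0 u - evm a0 u' by apply: raddfB.
have ev0 : evm a0 0 = 0 by apply: raddf0.
rewrite /move_coef; case: eqP => [ts|ts].
  have := card_lines_exact_eq UT (@flag_at_homo _ _ _ f') (fE h.+1) rP p rs (esym ts).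
  rewrite evB -lines => <-; rewrite natrD.
  case: andP => [[r_s /eqP ps]|_]; last by rewrite ev0 addr0 subr0.
  by rewrite sum_lt -?ps // evm_sqrt_v2 addrK.
case: (ltngtP (reach D h.+1) (reach (val z).2 h.+1)) => [st|st|st] /=; last by rewrite st in ts.
  have := card_lines_exact_lt UT (@flag_at_homo _ _ _ f') (fE h.+1) rP p rs st.
  case: eqP => [pt|_]; last first.
    by rewrite andbF addn0 => ->; rewrite ev0.
  rewrite andbT !sum_lt; try lia.
  move=> e; have := congr1 (fun k => k%:R : algC) e; rewrite natrD evB evm_sqrt_v2 => <-.
  by case: ifP => _; rewrite ?evm_sqrt_v2 ?ev0 ?subr0 ?addr0 ?addrK.
by rewrite (card_lines_exact_gt _ (fE h.+1) p st) ev0.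
Qed.

(** Reduces the multiplication formulas to a comparison of coefficients: no
    finite field or flag remains. *)
Lemma MS_mul_elementary (c : MS n d) :
  (forall z p, add_unit A h' p = add_unit (val z).1 h p ->
     (forall i, i != h.+1 -> reach D i = reach (val z).2 i) ->
     c z = move_coef h h' A D p (reach (val z).2 h.+1)) ->
  (forall z, (forall p, add_unit A h' p = add_unit (val z).1 h p ->
     (forall i, i != h.+1 -> reach D i = reach (val z).2 i) -> False) -> c z = 0) ->
  MS_mul (ebas d (map_mx Posz C) (val x).2) (ebas d (map_mx Posz A) D) = c.
Proof.
move=> c1 c0; apply: MS_mul_count => // [|F f f' w z zO].
  by case: (h) => i; lia.
have a0 : sqrtC #|F|%:R != 0 :> algC.
  by rewrite sqrtC_eq0 pnatr_eq0 -lt0n ltnW // finNzRing_gt1.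
rewrite -/(intermediate_flags x y f f' w) -/(evm a0 _).
have [[p [AB DE]]|no] := pselect (exists p, add_unit A h' p = add_unit (val z).1 h p /\
    (forall i, i != h.+1 -> reach D i = reach (val z).2 i)).
  by rewrite (c1 z p) // (card_intermediate_flags_ev a0 zO AB DE).
rewrite c0 ?raddf0 => [|p AB DE]; last by apply: no; exists p.
rewrite (_ : intermediate_flags _ _ _ _ _ = set0) ?cards0 //.
apply/setP => g; rewrite [RHS]inE; apply/negP => gP; apply: no.
by have [p AB DE] := intermediate_flags_move hh' zO x0 Cdiag gP; exists p.
Qed.

End ElementaryProduct.

(** * From reaches to decorations *)

Section DecoratedList.
Variables (n : nat) (D : {set 'I_n * 'I_n}).
Local Notation l := (dlist D).
Hypothesis Ds :
  sorted (fun x y : 'I_n * 'I_n => (x.1 < y.1)%N && (y.2 < x.2)%N) l.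

Lemma mem_dlist x : (x \in l) = (x \in D).
Proof. by rewrite mem_sort mem_enum. Qed.

Lemma drow_mem x : x \in D -> drow D (index x l).+1 = lbl x.1.
Proof.
move=> xD; rewrite /drow /= (nth_map x) ?nth_index ?index_mem ?mem_dlist //.
Qed.

Lemma dlist_nth_lt x0 i j : (i < j < size l)%N ->
  ((nth x0 l i).1 < (nth x0 l j).1)%N /\ ((nth x0 l j).2 < (nth x0 l i).2)%N.
Proof.
case/andP=> ij jl; apply/andP.
have tr : transitive (fun x y : 'I_n * 'I_n => (x.1 < y.1)%N && (y.2 < x.2)%N).
  by move=> a b c /andP[h1 h2] /andP[h3 h4]; rewrite (ltn_trans h1) // (ltn_trans h4).
by apply: (sorted_ltn_nth tr x0 Ds) => //; rewrite inE // (ltn_trans ij).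
Qed.

(** Interprets the list entries around the m-th one: since rows increase and
    columns decrease along the list, the next entry carries the largest column
    among the lower rows, and an element in an adjacent row is adjacent in the
    list. *)
Lemma drow_entry m (i : 'I_n) : drow D m = lbl i ->
  exists2 j : 'I_n, dcol D m = lbl j &
  [/\ (i, j) \in D, reach D i.+1 = dcol D m.+1,
      forall y, y \in D -> y.1 = i.+1 :> nat -> drow D m.+1 = lbl y.1
    & forall y, y \in D -> i = y.1.+1 :> nat -> drow D m.-1 = lbl y.1].
Proof.
case: m => [|k] //; rewrite {1}/drow /=.
have [kl|lk] := ltnP k (size l); last by rewrite nth_default ?size_map.
have [a aE] : exists a, a = nth (i, i) l k by exists (nth (i, i) l k).
rewrite (nth_map (i, i)) // -aE => -[/val_inj ai].
have memn k' : (k' < size l)%N -> nth (i, i) l k' \in D.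
  by move=> k'l; rewrite -mem_dlist mem_nth.
have iyP y : y \in D -> (index y l < size l)%N /\ nth (i, i) l (index y l) = y.
  by rewrite -mem_dlist => yl; rewrite index_mem nth_index.
have above y : y \in D -> (i < y.1)%N -> (k < index y l)%N.
  move=> /iyP[yl yE] iy; rewrite ltnNge leq_eqVlt; apply/negP => /orP[/eqP e|e].
    by move: iy; rewrite -yE e -aE ai ltnn.
  have := @dlist_nth_lt (i, i) (index y l) k; rewrite e kl yE -aE ai => /(_ isT)[].
  by move=> /(ltn_trans iy); rewrite ltnn.
exists a.2; first by rewrite /dcol /= (nth_map (i, i)) // -aE.
split.
- by rewrite -ai -surjective_pairing aE memn.
- rewrite /dcol /=; have [k1l|lk1] := ltnP k.+1 (size l); last first.
    rewrite nth_default ?size_map //; apply/eqP; rewrite -leqn0; apply/reach_leP.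
    by move=> y yD /(above y yD) ky; have [yl _] := iyP y yD; lia.
  rewrite (nth_map (i, i)) //; apply/eqP; rewrite eqn_leq; apply/andP; split.
    apply/reach_leP => y yD /(above y yD); have [yl yE] := iyP y yD.
    rewrite leq_eqVlt => /orP[/eqP ->|ky]; first by rewrite yE /lbl.
    have := @dlist_nth_lt (i, i) k.+1 (index y l); rewrite ky yl yE => /(_ isT)[_].
    by move=> /ltnW.
  apply: leq_reach; first exact: memn.
  by have := @dlist_nth_lt (i, i) k k.+1; rewrite ltnSn k1l -aE ai => /(_ isT)[].
- move=> y yD yi; have [yl yE] := iyP y yD; have ky : (k < index y l)%N.
    by apply: above => //; rewrite yi.
  have k1l : (k.+1 < size l)%N by apply: leq_ltn_trans ky yl.
  rewrite /drow /= (nth_map (i, i)) //; move: ky; rewrite leq_eqVlt => /orP[/eqP ->|ky].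
    by rewrite yE.
  have := @dlist_nth_lt (i, i) k k.+1; rewrite ltnSn k1l -aE ai => /(_ isT)[h1 _].
  have := @dlist_nth_lt (i, i) k.+1 (index y l); rewrite ky yl yE yi => /(_ isT)[h2 _].
  by move: h2; rewrite ltnS leqNgt h1.
- move=> y yD iy; have [yl yE] := iyP y yD.
  have yk : (index y l < k)%N.
    rewrite ltnNge leq_eqVlt; apply/negP => /orP[/eqP e|e].
      by move: iy; rewrite -yE -e -aE ai; lia.
    have := @dlist_nth_lt (i, i) k (index y l); rewrite e yl yE -aE ai => /(_ isT)[].
    by rewrite iy; lia.
  case: k kl aE above yk => // k kl aE above yk /=.
  rewrite /drow /= (nth_map (i, i)) ?(ltnW kl) //; move: yk; rewrite ltnS leq_eqVlt.
  case/orP => [/eqP <-|yk]; first by rewrite yE.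
  have := @dlist_nth_lt (i, i) k k.+1; rewrite ltnSn kl -aE ai => /(_ isT)[h1 _].
  have := @dlist_nth_lt (i, i) (index y l) k; rewrite yk (ltnW kl) yE => /(_ isT)[h2 _].
  by move: h1; rewrite iy ltnS leqNgt h2.
Qed.

End DecoratedList.

Lemma reach_skip n (D : {set 'I_n * 'I_n}) (i : nat) :
  (forall x, x \in D -> x.1 <> i :> nat) -> reach D i = reach D i.+1.
Proof.
move=> no; apply/eqP; rewrite eqn_leq (reach_homo D (leqnSn i)) andbT.
apply/reach_leP => x xD; rewrite leq_eqVlt => /orP[/eqP/esym/(no x xD) //|ix].
exact: leq_reach.
Qed.

Section Transfer.
Variables (n : nat) (h h' : 'I_n) (D : {set 'I_n * 'I_n}).
Hypothesis hh' : h' = h.+1 :> nat.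
Hypothesis Dc : antichain D.

Lemma eq_of_reach (E : {set 'I_n * 'I_n}) : antichain E ->
  (forall i, i != h.+1 -> reach D i = reach E i) ->
  (E == D) = (reach E h.+1 == reach D h.+1).
Proof.
move=> Ec DE; apply/eqP/eqP => [->//|e]; apply: reach_inj => // i.
by have [->|/DE] := eqVneq i h.+1.
Qed.

Variable t : 'I_n.

(** The antichain obtained from D by changing its reach at h.+1 to t.+1: (h', t)
    takes the place of whatever D has in row h', and an element in row h survives
    only if it stays a corner of the staircase. *)
Definition transfer : {set 'I_n * 'I_n} :=
  [set x | (x == (h', t)) || [&& x \in D, x.1 != h' & (x.1 == h) ==> (t < x.2)%N]].

Hypothesis st : (reach D h.+1 <= t)%N.
Hypothesis ts : (t < reach D h)%N.

Lemma transferP x : reflect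
  (x = (h', t) \/ [/\ x \in D, x.1 <> h' :> nat & x.1 = h :> nat -> (t < x.2)%N])
  (x \in transfer).
Proof.
rewrite inE; apply: (iffP orP) => -[/eqP ->|xP]; [by left| |by left; apply/eqP|].
  right; case/and3P: xP => xD xh /implyP xt; split=> //.
    by move=> /val_inj e; rewrite e eqxx in xh.
  by move=> /val_inj e; apply: xt; rewrite e.
right; case: xP => xD xh xt; rewrite xD -val_eqE /=; apply/andP; split; first exact/eqP.
by apply/implyP => /eqP e; apply: xt; rewrite e.
Qed.

Lemma reach_transfer i :
  reach transfer i = if i == h.+1 then t.+1 else reach D i.
Proof.
have ht : (h', t) \in transfer by apply/transferP; left.
apply/eqP; rewrite eqn_leq; apply/andP; split.
  apply/reach_leP => x /transferP[-> /=|[xD xh xt] ix].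
    by rewrite hh' leq_eqVlt; case: eqP => // _ ih; apply: leq_trans ts _; apply: reach_homo.
  case: eqP => [ih|_]; last exact: leq_reach.
  by rewrite ltnS (leq_trans _ st) // ltnW // leq_reach // -ih.
case: eqP => [->|ih]; first by apply: (leq_reach (x := (h', t))); rewrite //= hh'.
apply/reach_leP => x xD ix; case: (boolP (x \in transfer)) => [xt|xt].
  exact: leq_reach.
have [xt' ih'] : (x.2 <= t)%N /\ (i <= h')%N.
  have [xh|xh] := eqVneq (x.1 : nat) h'; last first.
    have [xh0|xh0] := eqVneq (x.1 : nat) h; last first.
      case/negP: xt; apply/transferP; right; split=> //; first exact/eqP.
      by move=> e; rewrite e eqxx in xh0.
    split; last by rewrite hh' -xh0 ltnW.
    rewrite leqNgt; apply: contra xt => tx; apply/transferP; right; split=> //.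
    exact/eqP.
  split; last by rewrite -xh.
  by apply: leq_trans st; apply: ltnW; apply: leq_reach; rewrite // xh hh'.
by apply: leq_ltn_trans xt' _; apply: (leq_reach ht).
Qed.

Lemma antichain_transfer : antichain transfer.
Proof.
have low y : y \in D -> (h' < y.1)%N -> (y.2 < t)%N.
  by move=> yD hy; apply: leq_trans st; apply: leq_reach => //; rewrite -hh' ltnW.
have high y : y \in D -> (y.1 < h)%N -> (t < y.2)%N.
  move=> yD yh; apply: leq_trans ts _; move: yD; rewrite mem_antichain // => /andP[_].
  by apply: leq_trans; apply: reach_homo.
move=> x y /transferP[->|[xD xh xt]] /transferP[->|[yD yh yt]] /=.
- by rewrite ltnn.
- split=> [/low -> //|e]; by rewrite e in yh.
- split=> [|e]; last by rewrite e in xh.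
  by rewrite hh' ltnS leq_eqVlt => /orP[/eqP/xt|/high ->].
- exact: Dc.
Qed.

Lemma eq_transfer (E : {set 'I_n * 'I_n}) : antichain E ->
  (forall i, i != h.+1 -> reach D i = reach E i) ->
  (E == transfer) = (reach E h.+1 == t.+1).
Proof.
move=> Ec DE; apply/eqP/eqP => [->|e]; first by rewrite reach_transfer eqxx.
apply: reach_inj => //; first exact: antichain_transfer.
by move=> i; rewrite reach_transfer; case: eqP => [->//|/eqP/DE].
Qed.

Lemma transfer_agrees i : i != h.+1 -> reach D i = reach transfer i.
Proof. by rewrite reach_transfer => /negPf ->. Qed.

End Transfer.

Section Evaluation.
Variables (n d : nat) (h h' : 'I_n) (A : 'M[nat]_n) (z : Xi n d).
Hypothesis hh' : h' = h.+1 :> nat.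

Lemma moveE p :
  (map_mx Posz (val z).1 == move h h' A p) = (add_unit A h' p == add_unit (val z).1 h p).
Proof.
apply/eqP/eqP => /matrixP e; apply/matrixP => i j; have := e i j; rewrite !mxE !xpair_eqE.
  by case: (_ && _); case: (_ && _) => /=; lia.
by case: (_ && _); case: (_ && _) => /=; lia.
Qed.

Lemma add_unit_inj p p' : add_unit A h' p = add_unit (val z).1 h p ->
  add_unit A h' p' = add_unit (val z).1 h p' -> p = p'.
Proof.
move=> /matrixP/(_ h' p) + /matrixP/(_ h' p); rewrite !mxE !xpair_eqE !eqxx /=.
rewrite (_ : h' == h = false) /= ?addn0; last by rewrite -val_eqE /=; lia.
by move=> <-; case: eqP => //; lia.
Qed.

Lemma eval_sum (Q : pred 'I_n) (a : 'I_n -> laurent) (G : 'I_n -> {set 'I_n * 'I_n}) :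
  (\sum_(p < n | Q p) (a p *: ebas d (move h h' A p) (G p) : MS n d)) z =
  \sum_(p < n | Q p) (if (add_unit A h' p == add_unit (val z).1 h p) && ((val z).2 == G p)
                      then a p else 0).
Proof.
rewrite sum_ffunE; apply: eq_bigr => p _; rewrite ffunE ebasE moveE.
by case: (_ && _); [apply: mulr1 | apply: mulr0].
Qed.

(** Only one column can account for the passage from A to the matrix of z. *)
Lemma eval_sum_moved p0 (Q : pred 'I_n) (a : 'I_n -> laurent)
    (G : 'I_n -> {set 'I_n * 'I_n}) :
  add_unit A h' p0 = add_unit (val z).1 h p0 ->
  (\sum_(p < n | Q p) (a p *: ebas d (move h h' A p) (G p) : MS n d)) z =
  if Q p0 && ((val z).2 == G p0) then a p0 else 0.
Proof.
move=> AB; rewrite eval_sum (big_mkcond Q) (bigD1 p0) //= AB eqxx big1 ?addr0 => [|p pp].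
  by case: (Q p0).
case: eqP => [/(add_unit_inj AB) e|_]; last by rewrite if_same.
by rewrite e eqxx in pp.
Qed.

Lemma eval_sum_none (Q : pred 'I_n) (a : 'I_n -> laurent)
    (G : 'I_n -> {set 'I_n * 'I_n}) :
  (forall p, Q p -> add_unit A h' p = add_unit (val z).1 h p -> (val z).2 = G p -> False) ->
  (\sum_(p < n | Q p) (a p *: ebas d (move h h' A p) (G p) : MS n d)) z = 0.
Proof.
move=> no; rewrite eval_sum big1 // => p Qp.
by case: eqP => [AB|//]; case: eqP => // e; case: (no p Qp AB e).
Qed.

End Evaluation.

(** * The multiplication formulas *)

Lemma geometric_step (K : fieldType) (x y : K) : x - 1 != 0 ->
  (y * x - 1) / (x - 1) = 1 + x * ((y - 1) / (x - 1)).
Proof. by move=> x1; field. Qed.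

Lemma qintS b : qint (b + 1) = 1 + v ^+ 2 * qint b.
Proof.
apply: val_inj; rewrite rmorphD rmorphM rmorph1 rmorphXn /= mulnDr exprD muln1.
have nz : vfrac ^+ 2 - 1 != 0.
  rewrite subr_eq0 -tofrac1 -tofracXn tofrac_eq; apply/eqP.
  by move/(congr1 (fun p : {poly int} => size p)); rewrite size_polyXn size_poly1.
exact: geometric_step.
Qed.

(** The number of lines at a position, less those that catch w one step too
    early. *)
Lemma shifted_qintS a b :
  v ^+ (2 * a) * qint (b + 1) - v ^+ (2 * a) = v ^+ (2 * (a + 1)) * qint b.
Proof. by rewrite qintS mulnDr exprD muln1 mulrDr mulr1 addrC addKr mulrA. Qed.

Theorem proposition4p1p3 (n d : nat) (n_gt0 : (0 < n)%N) (d_gt0 : (0 < d)%N)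
    (h h' : 'I_n) (hh' : lbl h' = (lbl h).+1)
    (C A : 'M[nat]_n) (D : {set 'I_n * 'I_n})
    (CXi : decorated d C set0) (AXi : decorated d A D)
    (roco : ro A = co C)
    (Cdiag : is_diag_mx (map_mx Posz C - delta_mx h' h)) :
  let lhs : MS n d := MS_mul (ebas d (map_mx Posz C) set0) (ebas d (map_mx Posz A) D) in
  let lt (p : 'I_n) : nat := (\sum_(j < n | (lbl j < lbl p)%N) A h' j)%N in
  (* (a) *)
  [/\ (forall t : nat, drow D t <> lbl h /\ drow D t <> lbl h') ->
      lhs = \sum_(p < n | (1 <= A h p)%N)
               (v ^+ (2 * lt p) * qint (A h' p + 1)) *: ebas d (move h h' A p) D,
  (* (b) *)
      forall (m : nat) (jm : 'I_n),
      drow D m = lbl h -> dcol D m = lbl jm -> drow D m.+1 <> lbl h' ->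
      let le : nat := (\sum_(j < n | (lbl j <= dcol D m.+1)%N) A h' j)%N in
      lhs = \sum_(p < n | (1 <= A h p)%N)
               (v ^+ (2 * lt p) * qint (A h' p + 1)) *: ebas d (move h h' A p) D
           + \sum_(t < n | (dcol D m.+1 + 1 <= lbl t <= lbl jm - 1)%N)
               v ^+ (2 * le) *: ebas d (move h h' A t) (D :|: [set (h', t)])
           + v ^+ (2 * le) *: ebas d (move h h' A jm)
                                ((D :\: [set (h, jm)]) :|: [set (h', jm)]),
  (* (c) *)
      forall (m : nat) (jm : 'I_n),
      drow D m.-1 <> lbl h -> drow D m = lbl h' -> dcol D m = lbl jm ->
      lhs = \sum_(p < n | (p != jm) && (1 <= A h p)%N)
               (v ^+ (2 * lt p) * qint (A h' p + 1)) *: ebas d (move h h' A p) D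
           + \sum_(p < n | (p == jm) && (1 <= A h p)%N)
               (v ^+ (2 * (lt p + 1)) * qint (A h' p)) *: ebas d (move h h' A p) D
  (* (d) *)
    & forall (m : nat) (jm jm1 : 'I_n),
      drow D m = lbl h -> dcol D m = lbl jm ->
      drow D m.+1 = lbl h' -> dcol D m.+1 = lbl jm1 ->
      let le : nat := (\sum_(j < n | (lbl j <= lbl jm1)%N) A h' j)%N in
      lhs = \sum_(p < n | ((1 <= lbl p <= lbl jm1 - 1)%N || (lbl jm1 + 1 <= lbl p <= n)%N)
                           && (1 <= A h p)%N)
               (v ^+ (2 * lt p) * qint (A h' p + 1)) *: ebas d (move h h' A p) D
           + \sum_(p < n | (p == jm1) && (1 <= A h p)%N)
               (v ^+ (2 * (lt p + 1)) * qint (A h' p)) *: ebas d (move h h' A p) D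
           + \sum_(p < n | (p == jm) && (1 <= A h p)%N)
               (v ^+ (2 * le) - v ^+ (2 * lt jm1)) *:
                 ebas d (move h h' A p)
                   ((D :\: [set (h, jm); (h', jm1)]) :|: [set (h', jm)])
           + \sum_(t < n | (lbl jm1 + 1 <= lbl t <= lbl jm - 1)%N && (1 <= A h t)%N)
               (v ^+ (2 * le) - v ^+ (2 * lt jm1)) *:
                 ebas d (move h h' A t)
                   ((D :\: [set (h', jm1)]) :|: [set (h', t)])].
Proof.
move=> lhs lt.
have hh : h' = h.+1 :> nat by case: hh'.
have /and3P[_ Ds _] := AXi; rewrite /= in Ds.
have /decoratedE[_ Dc Dpos] := AXi.
have key c := @MS_mul_elementary n d h h' (XiOf (Xi_val := (C, set0)) CXi)
  (XiOf (Xi_val := (A, D)) AXi) hh erefl Cdiag roco c.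
rewrite /= in key.
have ltE p : lt p = row_sum h' A p by [].
have zc (z : Xi n d) : antichain (val z).2.
  by have /decoratedE[] := Xi_decorated z.
have Ahp (z : Xi n d) p : add_unit A h' p = add_unit (val z).1 h p -> (0 < A h p)%N.
  move=> /matrixP/(_ h p); rewrite !mxE !xpair_eqE !eqxx /=.
  by rewrite -val_eqE /= hh ltn_eqF // addn0 addn1 => ->.
have bounds (z : Xi n d) : (forall i, i != h.+1 -> reach D i = reach (val z).2 i) ->
    (reach D h.+2 <= reach (val z).2 h.+1)%N /\ (reach (val z).2 h.+1 <= reach D h)%N.
  move=> DE; rewrite (DE h.+2) ?(DE h); first by split; apply: reach_homo.
    by rewrite ltn_eqF.
  by rewrite gtn_eqF.
have rowh (b : 'I_n) : (h, b) \in D -> reach D h = b.+1 /\ (reach D h.+1 <= b)%N.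
  by rewrite mem_antichain // => /andP[/eqP].
have rowh' (b : 'I_n) : (h', b) \in D -> reach D h.+1 = b.+1 /\ (reach D h.+2 <= b)%N.
  by rewrite mem_antichain //= hh => /andP[/eqP].
have addE (c c' : MS n d) z : (c + c') z = c z + c' z by rewrite ffunE.
have rowh_uniq (x : 'I_n * 'I_n) i b : x \in D -> (i, b) \in D -> x.1 = i -> x.2 = b.
  by move=> xD bD xi; rewrite ((Dc x (i, b) xD bD).2 xi).
split.
- move=> noh.
  (* D meets neither of the rows h and h', so that r = s = sigma. *)
  have s_sigma : reach D h = reach D h.+1.
    apply: reach_skip => x xD /val_inj xh; have [+ _] := noh (index x (dlist D)).+1.
    by rewrite drow_mem // xh.
  have r_s : reach D h.+1 = reach D h.+2.
    apply: reach_skip => x xD; rewrite -hh => /val_inj xh.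
    have [_] := noh (index x (dlist D)).+1.
    by rewrite drow_mem // xh.
  apply: key => [z p AB DE|z no].
    have [tr ts] := bounds z DE.
    rewrite (eval_sum_moved hh _ _ _ AB) (Ahp z p AB) (eq_of_reach Dc (zc z) DE) /move_coef.
    rewrite -r_s ltnn subr0; case: eqP => [//|ne]; case: ne; lia.
  apply: (eval_sum_none hh) => p _ AB zD; apply: (no p AB) => i _; by rewrite zD.
- move=> m jm dm cm dm1 le.
  (* D meets row h but not row h', so that r = s < sigma; t ranges over [s, sigma]. *)
  have [j + [jD s_next above _]] := drow_entry Ds dm.
  rewrite cm => -[/val_inj jE]; rewrite -{j}jE in jD.
  have [sigmaE s_jm] := rowh jm jD.
  have noh' x : x \in D -> x.1 != h'.
    move=> xD; apply/eqP => xh; apply: dm1; rewrite -xh.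
    by apply: above => //; rewrite xh.
  have r_s : reach D h.+1 = reach D h.+2.
    by apply: reach_skip => x xD; rewrite -hh => /val_inj/eqP; apply/negP/noh'.
  have leE : le = row_sum h' A (reach D h.+1) by rewrite /le -s_next.
  have D1 (t : 'I_n) : (t < jm)%N -> D :|: [set (h', t)] = transfer h h' D t.
    move=> tj; apply/setP => x; rewrite !inE orbC; congr (_ || _).
    case xD: (x \in D) => //=; rewrite noh' //=; symmetry; apply/implyP => /eqP xh.
    by rewrite (rowh_uniq x h jm).
  have D2 : (D :\: [set (h, jm)]) :|: [set (h', jm)] = transfer h h' D jm.
    apply/setP => x; rewrite !inE orbC; congr (_ || _); rewrite andbC.
    case xD: (x \in D) => //=; rewrite noh' //=.
    have [xh|xh] := eqVneq x.1 h; last first.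
      by apply/eqP => xE; rewrite xE eqxx in xh.
    rewrite (rowh_uniq x h jm) // ltnn [x]surjective_pairing xh (rowh_uniq x h jm) //.
    by rewrite eqxx.
  have single (g : 'I_n -> MS n d) : \sum_(p < n | p == jm) g p = g jm.
    exact: big_pred1_eq.
  rewrite -[X in _ + _ + X](single (fun p => v ^+ (2 * le) *:
    ebas d (move h h' A p) ((D :\: [set (h, jm)]) :|: [set (h', jm)]))).
  apply: key => [z p AB DE|z no].
    have [tr ts] := bounds z DE.
    rewrite !addE !(eval_sum_moved hh _ _ _ AB) (Ahp z p AB) (eq_of_reach Dc (zc z) DE).
    set t := reach (val z).2 h.+1 in tr ts *; rewrite /=.
    have -> : (dcol D m.+1 + 1 <= lbl p <= lbl jm - 1)%N
        && ((val z).2 == D :|: [set (h', p)])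
      = [&& reach D h.+1 < t, p.+1 == t & p < jm]%N.
      rewrite -s_next /lbl; have [/andP[sp pj]|out] := boolP (reach D h.+1 <= p < jm)%N.
        rewrite D1 // (eq_transfer hh Dc sp _ (zc z) DE) -/t; lia.
      by rewrite [LHS](_ : _ = false); lia.
    have -> : (p == jm) && ((val z).2 == D :\: [set (h, jm)] :|: [set (h', jm)])
      = (p.+1 == t) && (p == jm).
      rewrite andbC; have [->|//] := eqVneq p jm; rewrite ?andbF // !andbT.
      by rewrite D2 (eq_transfer hh Dc s_jm _ (zc z) DE) ?sigmaE // -/t eq_sym.
    rewrite /move_coef -/t -r_s ltnn !subr0 leE.
    have [tE|tN] := eqVneq t (reach D h.+1).
      rewrite tE ltnn /= addr0; case: eqP => [pE|]; last by rewrite addr0.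
      case: eqP => [pj|]; last by rewrite addr0.
      by rewrite pj in pE; lia.
    have st : (reach D h.+1 < t)%N by lia.
    rewrite st /= add0r; case: eqP => [pt|]; last by rewrite addr0.
    have [pj|] := eqVneq p jm; first by rewrite pj ltnn add0r.
    by rewrite -val_eqE /= => pj; rewrite ifT ?addr0 //; lia.
  rewrite !addE !(eval_sum_none hh) ?addr0 // => [p /eqP -> AB|p pj AB|p _ AB].
  - rewrite D2 => zE; apply: (no _ AB) => i ih; rewrite zE.
    by apply: transfer_agrees; rewrite ?sigmaE.
  - move: pj; rewrite -s_next /lbl => pj; rewrite D1; last by lia.
    move=> zE; apply: (no _ AB) => i ih; rewrite zE.
    by apply: transfer_agrees => //; lia.
  - by move=> zE; apply: (no _ AB) => i ih; rewrite zE.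
- move=> m jm dm0 dm cm.
  (* D meets row h' but not row h, so that r < s = sigma and t <= s. *)
  have [j + [jD s_next _ below]] := drow_entry Ds dm.
  rewrite cm => -[/val_inj jE]; rewrite -{j}jE in jD.
  have [sE r_jm] := rowh' jm jD.
  have s_sigma : reach D h = reach D h.+1.
    apply: reach_skip => x xD xh; apply: dm0; rewrite (below x xD) ?hh ?xh //.
    by rewrite /lbl xh.
  apply: key => [z p AB DE|z no].
    have [tr ts] := bounds z DE.
    rewrite !addE !(eval_sum_moved hh _ _ _ AB) (Ahp z p AB) (eq_of_reach Dc (zc z) DE).
    rewrite /move_coef sE ltnS r_jm eqSS val_eqE /= !andbT.
    rewrite s_sigma sE in ts.
    have [tE|tN] := eqVneq (reach (val z).2 h.+1) jm.+1; rewrite ?andbT ?andbF.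
      have [->|pj] := eqVneq p jm; first by rewrite add0r shifted_qintS.
      by rewrite addr0 subr0.
    by rewrite addr0 [(jm.+1 < _)%N]ltnNge ts.
  rewrite !addE !(eval_sum_none hh) ?addr0 // => p _ AB zD.
    by apply: (no p AB) => i _; rewrite zD.
  by apply: (no p AB) => i _; rewrite zD.
- move=> m jm jm1 dm cm dm1 cm1 le.
  (* D meets both rows, so that r < s < sigma. *)
  have [j + [jD s_next _ _]] := drow_entry Ds dm.
  rewrite cm => -[/val_inj jE]; rewrite -{j}jE in jD.
  have [j + [j1D _ _ _]] := drow_entry Ds dm1.
  rewrite cm1 => -[/val_inj jE]; rewrite -{j}jE in j1D.
  have [sigmaE s_jm] := rowh jm jD.
  have [sE r_jm1] := rowh' jm1 j1D.
  have leE : le = row_sum h' A jm1.+1 by [].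
  have xh' x : x \in D -> x.1 = h' -> x = (h', jm1).
    by move=> xD xh; rewrite [x]surjective_pairing (rowh_uniq x h' jm1) ?xh.
  have xh x : x \in D -> x.1 = h -> x = (h, jm).
    by move=> xD xe; rewrite [x]surjective_pairing (rowh_uniq x h jm) ?xe.
  have h_h' : h != h' by rewrite -val_eqE /= hh ltn_eqF.
  have D1 : (D :\: [set (h, jm); (h', jm1)]) :|: [set (h', jm)] = transfer h h' D jm.
    apply/setP => x; rewrite !inE orbC; congr (_ || _); rewrite andbC.
    case xD: (x \in D) => //=; have [e|ne] := eqVneq x.1 h'.
      by rewrite (xh' x) // eqxx orbT.
    have [e|ne'] := eqVneq x.1 h; first by rewrite (xh x) // eqxx ltnn.
    apply/negP => /orP[] /eqP xE; first by rewrite xE eqxx in ne'.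
    by rewrite xE eqxx in ne.
  have D2 (t : 'I_n) : (t < jm)%N ->
      (D :\: [set (h', jm1)]) :|: [set (h', t)] = transfer h h' D t.
    move=> tj; apply/setP => x; rewrite !inE orbC; congr (_ || _); rewrite andbC.
    case xD: (x \in D) => //=; have [e|ne] := eqVneq x.1 h'.
      by rewrite (xh' x) // eqxx.
    rewrite /= [RHS](_ : _ = true); last first.
      by apply/implyP => /eqP /(xh x xD) ->.
    by apply: contra ne => /eqP ->.
  apply: key => [z p AB DE|z no].
    have [tr ts] := bounds z DE.
    rewrite !addE !(eval_sum_moved hh _ _ _ AB) (Ahp z p AB) (eq_of_reach Dc (zc z) DE).
    set t := reach (val z).2 h.+1 in tr ts *; rewrite !andbT.
    have -> : ((1 <= lbl p <= lbl jm1 - 1)%N || (lbl jm1 + 1 <= lbl p <= n)%N) = (p != jm1).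
      by rewrite -val_eqE /lbl /=; have := ltn_ord p; lia.
    have -> : (p == jm) && ((val z).2 == D :\: [set (h, jm); (h', jm1)] :|: [set (h', jm)])
      = (p.+1 == t) && (p == jm).
      rewrite andbC; have [->|//] := eqVneq p jm; rewrite ?andbF // !andbT.
      by rewrite D1 (eq_transfer hh Dc s_jm _ (zc z) DE) ?sigmaE // -/t eq_sym.
    have -> : (lbl jm1 + 1 <= lbl p <= lbl jm - 1)%N
        && ((val z).2 == D :\: [set (h', jm1)] :|: [set (h', p)])
      = [&& jm1.+1 < t, p.+1 == t & p < jm]%N.
      rewrite /lbl; have [/andP[sp pj]|out] := boolP (jm1 < p < jm)%N.
        rewrite D2 // (eq_transfer hh Dc (_ : reach D h.+1 <= p)%N _ (zc z) DE) ?sE -/t; lia.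
      by rewrite [LHS](_ : _ = false); lia.
    rewrite /move_coef -/t sE ltnS r_jm1 eqSS val_eqE /= leE.
    have [tE|tN] := eqVneq t jm1.+1.
      rewrite tE ltnn andbT /= addr0 andbT.
      have [->|pj] := eqVneq p jm1.
        rewrite add0r shifted_qintS eqxx /= ifF ?addr0 // -val_eqE /=.
        by rewrite ltn_eqF // -sE.
      rewrite addr0 subr0; case: eqP => [[/val_inj e]|]; last by rewrite addr0.
      by rewrite e eqxx in pj.
    rewrite !andbF !add0r; case: (ltnP jm1.+1 t) => st; last first.
      case: eqP => [pt|]; last by rewrite addr0.
      case: eqP => [e|]; last by rewrite addr0.
      by rewrite -pt e in st; rewrite sE in s_jm; lia.
    case: eqP => [pt|]; last by rewrite addr0.
    have [pj|] := eqVneq p jm; first by rewrite pj ltnn addr0.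
    by rewrite -val_eqE /= => pj; rewrite add0r ifT //; lia.
  rewrite !addE !(eval_sum_none hh) ?addr0 // => [p pj AB|p /andP[/eqP -> _] AB|p _ AB|p _ AB].
  - rewrite D2; last by move: pj; rewrite /lbl; lia.
    move=> zE; apply: (no _ AB) => i ih; rewrite zE.
    by apply: transfer_agrees => //; move: pj; rewrite /lbl; lia.
  - rewrite D1 => zE; apply: (no _ AB) => i ih; rewrite zE.
    by apply: transfer_agrees; rewrite ?sigmaE.
  - by move=> zE; apply: (no _ AB) => i ih; rewrite zE.
  - by move=> zE; apply: (no _ AB) => i ih; rewrite zE.
Qed.
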